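(* Let $\Omega$, $\Gamma$, $\Omega^\pm$, $\beta$, $\mathbf{n}$, $B$ be as in the context, let $f\in L^2(\Omega)$, $g\in H^1(\Omega)$, $a,b\in H^1_0(\Omega)$, and let $F$ be the functional in the context. For every $h>0$ let $H^{1,h}_0$ be a finite-dimensional real vector space with norm $\|\cdot\|_h$, let $T^h:H^{1,h}_0\to H^1_0(\Omega)$ be a map (not assumed linear), $B^h[\cdot,\cdot]$ a bilinear form on $H^{1,h}_0$ and $F^h$ a linear functional on $H^{1,h}_0$. Assume there are positive constants $C_0,C_1,C_2,C_3$ independent of $h$ such that: (i) $\|T^h(\psi^h)\|_{H^1_0(\Omega)}\le C_0\|\psi^h\|_h$ for all $\psi^h\in H^{1,h}_0$; (ii) for every $\psi\in H^1_0(\Omega)$ there exist $\psi^h\in H^{1,h}_0$ with $T^h(\psi^h)\to\psi$ in $H^1_0(\Omega)$ as $h\to0$; (iii) $C_1\|u^h\|_h^2\le B^h[u^h,u^h]$ and $|B^h[u^h,v^h]|\le C_2\|u^h\|_h\|v^h\|_h$ for all $u^h,v^h\in H^{1,h}_0$; (iv) $|F^h(\psi^h)|\le C_3\|\psi^h\|_h$ for all $\psi^h\in H^{1,h}_0$; (v) whenever $v^h,\psi^h\in H^{1,h}_0$ satisfy $T^h(v^h)\rightharpoonup v$ weakly in $H^1_0(\Omega)$ and $T^h(\psi^h)\to\psi$ strongly in $H^1_0(\Omega)$ as $h\to0$, one has $B^h[v^h,\psi^h]\to B[v,\psi]$ and $F^h(\psi^h)\to F(\psi)$. Then for every $h>0$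 there exists a unique $v^h\in H^{1,h}_0$ such that $-B^h[v^h,\psi^h]=F^h(\psi^h)$ for every $\psi^h\in H^{1,h}_0$. Moreover, as $h\to0$, $T^h(v^h)$ converges weakly in $H^1_0(\Omega)$ to $v=u-g+a\chi_{\Omega^-}$, where $u$ is the unique function with $u-g+a\chi_{\Omega^-}\in H^1_0(\Omega)$ satisfying $-B[u-g+a\chi_{\Omega^-},\psi]=F(\psi)$ for all $\psi\in H^1_0(\Omega)$.
   Context: $\Omega\subset\mathbb{R}^n$ is a bounded domain with smooth boundary. $\Gamma\subset\Omega$ is a smooth hypersurface, the zero level set of a smooth function $\phi$ which near $\Gamma$ is the signed distance function to $\Gamma$. $\Omega^-=\{\phi<0\}$, $\Omega^+=\{\phi>0\}$, $\partial\Omega^-=\Gamma$, $\Omega=\Omega^+\cup\Omega^-\cup\Gamma$ (disjoint union). $\mathbf{n}=\nabla\phi/|\nabla\phi|$ on $\Gamma$ is the unit normal pointing from $\Omega^-$ to $\Omega^+$; in volume integrals over $\Omega^-$, $\mathbf{n}$ denotes a $C^1$ extension of this normal field to $\overline{\Omega^-}$ (the value of $\int_{\Omega^-}\nabla\cdot(b\psi\,\mathbf{n})=\int_\Gamma b\psi\,ds$ does not depend on the extension). $\beta(x)$ is a symmetric positive definite $n\times n$ matrix whose entries are $C^1$ on the closure of each of $\Omega^-$ and $\Omega^+$ (possibly discontinuous across $\Gamma$, where $\beta$ takes the limiting values from $\Omega^-$), with $m\,\mathrm{Id}\le\beta(x)\le M\,\mathrm{Id}$ for constants $0<m<M$. $\chi_{\Omega^-}$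 is the characteristic function of $\Omega^-$. $B[u,v]=\int_\Omega\beta\nabla u\cdot\nabla v$, and $H^1_0(\Omega)$ carries the inner product $B$ and norm $\|u\|_{H^1_0(\Omega)}=B[u,u]^{1/2}$ (equivalent to the usual one). For $\psi\in H^1_0(\Omega)$, $$F(\psi)=\int_\Omega f\psi+\int_\Omega\beta\nabla g\cdot\nabla\psi-\int_{\Omega^-}\beta\nabla a\cdot\nabla\psi+\int_{\Omega^-}\nabla\cdot(b\psi\,\mathbf{n}).$$ *)

(* Defs.v *)
From HB Require Import structures.
From mathcomp Require Import all_boot all_order all_algebra.
From mathcomp Require Import all_classical all_reals all_analysis.

Set Implicit Arguments.
Unset Strict Implicit.
Unset Printing Implicit Defensive.
Import Order.TTheory GRing.Theory Num.Theory.
Import numFieldNormedType.Exports.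

Local Open Scope classical_set_scope.
Local Open Scope ring_scope.

(* R^n with the product sigma-algebra, that is, the Borel sets. *)
Section measurable_rV.
Context {d} {T : measurableType d} (n : nat).

Let coord : 'I_n -> 'rV[T]_n -> T := fun i x => x ord0 i.

Let rV_set0 : g_sigma_preimage coord set0.
Proof. exact: sigma_algebra0. Qed.

Let rV_setC A : g_sigma_preimage coord A -> g_sigma_preimage coord (~` A).
Proof. exact: sigma_algebraC. Qed.

Let rV_bigcup (F : _^nat) : (forall i, g_sigma_preimage coord (F i)) ->
  g_sigma_preimage coord (\bigcup_i (F i)).
Proof. exact: sigma_algebra_bigcup. Qed.

HB.instance Definition _ := @isMeasurable.Build (measure_tuple_display d)
  'rV[T]_n (g_sigma_preimage coord) rV_set0 rV_setC rV_bigcup.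

Lemma measurable_coord (i : 'I_n) :
  measurable_fun [set: 'rV[T]_n] (fun x => x ord0 i).
Proof.
move=> _ Y mY; rewrite setTI; apply: sub_sigma_algebra => /=.
rewrite -bigcup_seq/=; exists i => /=; first by rewrite mem_index_enum.
by exists Y => //; rewrite setTI.
Qed.

Lemma measurable_fun_rVP d1 (T1 : measurableType d1) (f : T1 -> 'rV[T]_n) :
  (forall i, measurable_fun [set: T1] (fun t => f t ord0 i)) ->
  measurable_fun [set: T1] f.
Proof.
move=> mf _ A mA; rewrite setTI.
suff : g_sigma_preimage coord `<=` [set B | measurable (f @^-1` B)] by exact.
apply: smallest_sub.
  split; rewrite /mkset.
  - by rewrite preimage_set0.
  - by move=> B mB; rewrite setTD preimage_setC; exact: measurableC.
  - by move=> F mF; rewrite preimage_bigcup; exact: bigcup_measurable.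
rewrite -bigcup_seq/= => B [i _ [C mC <-]].
by rewrite /mkset setTI -comp_preimage -[_ @^-1` _]setTI; exact: mf.
Qed.

End measurable_rV.

Section cons_rV.
Context {R : realType} (n : nat).

Definition cons_rV (p : R * 'rV[R]_n) : 'rV[R]_n.+1 :=
  row_mx p.1%:M p.2.

Lemma cons_rV0 p : cons_rV p ord0 ord0 = p.1.
Proof.
have e : ord0 = lshift n (ord0 : 'I_1) :> 'I_(1 + n) by exact: val_inj.
rewrite [X in cons_rV p _ X]e; apply: etrans (row_mxEl _ _ _ _) _.
by rewrite mxE eqxx.
Qed.

Lemma cons_rVS p i : cons_rV p ord0 (lift ord0 i) = p.2 ord0 i.
Proof. by rewrite -rshift1; exact: etrans (row_mxEr _ _ _ _) _. Qed.

Lemma measurable_cons_rV : measurable_fun setT cons_rV.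
Proof.
apply: measurable_fun_rVP => i.
have [j ->|->] := unliftP ord0 i.
  under eq_fun do rewrite cons_rVS.
  exact: (measurableT_comp (measurable_coord j)).
under eq_fun do rewrite cons_rV0.
exact: measurable_fst.
Qed.

Let uncons (v : 'rV[R]_n.+1) : R * 'rV[R]_n :=
  (v ord0 ord0, \row_i v ord0 (lift ord0 i)).

Let cons_rVK : cancel cons_rV uncons.
Proof.
move=> [x v]; rewrite /uncons cons_rV0; congr pair.
by apply/rowP => i; rewrite mxE cons_rVS.
Qed.

Let unconsK : cancel uncons cons_rV.
Proof.
move=> v; apply/rowP => i; have [j ->|->] := unliftP ord0 i.
  by rewrite cons_rVS mxE.
by rewrite cons_rV0.
Qed.

Let measurable_uncons : measurable_fun setT uncons.
Proof.
apply: measurable_fun_pair; first exact: measurable_coord.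
apply: measurable_fun_rVP => i.
under eq_fun do rewrite mxE.
exact: measurable_coord.
Qed.

Variable mu : {sigma_finite_measure set 'rV[R]_n -> \bar R}.

Definition lebesgue_cons : set 'rV[R]_n.+1 -> \bar R :=
  pushforward (@lebesgue_measure R \x mu)%E cons_rV.

Let lebesgue_cons0 : lebesgue_cons set0 = 0%E.
Proof. by rewrite /lebesgue_cons /pushforward preimage_set0 measure0. Qed.

Let lebesgue_cons_ge0 A : (0 <= lebesgue_cons A)%E.
Proof. by rewrite /lebesgue_cons /pushforward; exact: measure_ge0. Qed.

Let lebesgue_cons_sigma_additive : semi_sigma_additive lebesgue_cons.
Proof.
have mcons := measurable_cons_rV.
move=> F mF tF mUF; rewrite /lebesgue_cons /pushforward preimage_bigcup.
apply: measure_semi_sigma_additive.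
- by move=> k; rewrite -[X in measurable X]setTI; exact: mcons.
- apply/trivIsetP => /= i j _ _ ij; rewrite -preimage_setI.
  by move/trivIsetP : tF => /(_ _ _ _ _ ij) ->//; rewrite preimage_set0.
- by rewrite -preimage_bigcup -[X in measurable X]setTI; exact: mcons.
Qed.

HB.instance Definition _ := isMeasure.Build _ _ _ lebesgue_cons
  lebesgue_cons0 lebesgue_cons_ge0 lebesgue_cons_sigma_additive.

Let lebesgue_cons_sigma_finite : sigma_finite setT lebesgue_cons.
Proof.
have /sigma_finiteP[F [TF ndF Foo]] := sigma_finiteT (@lebesgue_measure R).
have /sigma_finiteP[G [TG ndG Goo]] := sigma_finiteT mu.
exists (fun k => uncons @^-1` (F k `*` G k)).
  rewrite -preimage_bigcup -(preimage_setT uncons); congr (_ @^-1` _).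
  rewrite -setXTT TF TG predeqE => -[x y]; split.
    move=> [/= [i _ Fix] [j _ Gjy]]; exists (maxn i j) => //; split.
    - by move: x Fix; exact/subsetPset/ndF/leq_maxl.
    - by move: y Gjy; exact/subsetPset/ndG/leq_maxr.
  by move=> [i _ []/= ? ?]; split; exists i.
move=> k; have [? ?] := Foo k; have [? ?] := Goo k; split.
  by rewrite -[X in measurable X]setTI; apply: measurable_uncons => //;
    exact: measurableX.
rewrite /lebesgue_cons /pushforward -comp_preimage.
rewrite (_ : uncons \o cons_rV = id); last by apply/funext => p; exact: cons_rVK.
by rewrite preimage_id product_measure1E// lte_mul_pinfty// ge0_fin_numE.
Qed.

HB.instance Definition _ := Measure_isSigmaFinite.Build _ _ _ lebesgue_cons
  lebesgue_cons_sigma_finite.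

End cons_rV.

(* On R^(n+1) = R * R^n, the product of the measures of the two factors. *)
Fixpoint lebesgue_rV (R : realType) (n : nat) :
    {sigma_finite_measure set 'rV[R]_n -> \bar R} :=
  match n with
  | 0%N => [the {sigma_finite_measure set 'rV[R]_0 -> \bar R} of \d_(0 : 'rV[R]_0)]
  | n'.+1 => [the {sigma_finite_measure set 'rV[R]_n'.+1 -> \bar R} of
              lebesgue_cons (lebesgue_rV R n')]
  end.

Lemma lebesgue_rV_box (R : realType) (n : nat) (A : 'I_n -> set R) :
  (forall i, measurable (A i)) ->
  lebesgue_rV R n [set x | forall i, A i (x ord0 i)] =
    (\prod_i lebesgue_measure (A i))%E.
Proof.
elim: n A => [|n IH] A mA.
  rewrite big_ord0 /= diracE mem_set// => -[].
  by [].
rewrite big_ord_recl -IH//=.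
have mB : measurable [set x : 'rV[R]_n | forall i, A (lift ord0 i) (x ord0 i)].
  rewrite (_ : mkset _ =
      \bigcap_i ((fun x : 'rV_n => x ord0 i) @^-1` A (lift ord0 i))).
    apply: fin_bigcap_measurable => // i _.
    by rewrite -[X in measurable X]setTI; exact: measurable_coord.
  by apply/seteqP; split => x /= Ax i//; [move=> _|]; exact: Ax.
rewrite -product_measure1E//=; last exact: mA.
congr (product_measure1 _ _ _); apply/seteqP; split => -[x v] /=.
- move=> H; split; first by have := H ord0; rewrite cons_rV0.
  by move=> i; have := H (lift ord0 i); rewrite cons_rVS.
- move=> [Ax Av] i; have [j ->|->] := unliftP ord0 i.
    by rewrite cons_rVS; exact: Av.
  by rewrite cons_rV0.
Qed.

Section calculus.
Context {R : realType} {n : nat}.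
Implicit Types (U D : set 'rV[R]_n) (f : 'rV[R]_n -> R) (x y z w : 'rV[R]_n).

Definition partial (i : 'I_n) f : 'rV[R]_n -> R :=
  fun x => 'D_(delta_mx ord0 i) f x.

Definition grad f : 'rV[R]_n -> 'rV[R]_n := fun x => \row_i partial i f x.

(* The norm that the library puts on 'rV[R]_n is the sup norm. *)
Definition dotp x y : R := \sum_i x ord0 i * y ord0 i.
Definition norm2 x : R := Num.sqrt (dotp x x).

(* (A w) . z, for w and z seen as column vectors *)
Definition mxdot (A : 'M[R]_n) w z : R := (z *m A *m w^T) ord0 ord0.

Fixpoint Ck_on (k : nat) U f : Prop :=
  (forall x, U x -> {for x, continuous f}) /\
  match k with
  | 0%N => True
  | k'.+1 => forall i, (forall x, U x -> derivable f x (delta_mx ord0 i)) /\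
                       Ck_on k' U (partial i f)
  end.

Definition smooth_on U f : Prop := forall k, Ck_on k U f.

(* C^1 on the closure of the open set D: f is C^1 in D, and f and its partial
   derivatives extend continuously to the closure, f by its own values. *)
Definition C1_closure D f : Prop :=
  [/\ Ck_on 1 D f,
      {within closure D, continuous f} &
      forall i, exists2 g : 'rV[R]_n -> R,
        {within closure D, continuous g} & forall x, D x -> g x = partial i f x].

Definition boundary D : set 'rV[R]_n := closure D `\` interior D.

Definition smooth_boundary D : Prop :=
  forall p, boundary D p -> exists U rho,
    [/\ open U, U p, smooth_on U rho, forall x, U x -> grad rho x != 0 &
        D `&` U = [set x | rho x < 0] `&` U].

Definition smooth_hypersurface (G : set 'rV[R]_n) : Prop :=
  forall p, G p -> exists U rho,
    [/\ open U, U p, smooth_on U rho, forall x, U x -> grad rho x != 0 &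
        G `&` U = [set x | rho x = 0] `&` U].

Definition smooth_bounded_domain D : Prop :=
  [/\ open D, D !=set0, connected D, bounded_set D & smooth_boundary D].

Definition dist (G : set 'rV[R]_n) x : R := inf [set norm2 (x - y) | y in G].

End calculus.

Section interface.
Context {R : realType} {n : nat}.
Variables (Om : set 'rV[R]_n) (phi : 'rV[R]_n -> R).

Definition Omega_minus : set 'rV[R]_n := Om `&` [set x | phi x < 0].
Definition Omega_plus : set 'rV[R]_n := Om `&` [set x | 0 < phi x].
Definition Gamma : set 'rV[R]_n := Om `&` [set x | phi x = 0].

Definition signed_dist (x : 'rV[R]_n) : R :=
  if x \in Omega_minus then - dist Gamma x else dist Gamma x.

Definition interface : Prop :=
  [/\ smooth_on Om phi,
      smooth_hypersurface Gamma,
      boundary Omega_minus = Gamma &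
      exists2 U, open U & Gamma `<=` U /\
        forall x, Om x -> U x -> phi x = signed_dist x].

Definition normal_extension (nu : 'rV[R]_n -> 'rV[R]_n) : Prop :=
  (forall i, C1_closure Omega_minus (fun x => nu x ord0 i)) /\
  (forall x, Gamma x -> nu x = (norm2 (grad phi x))^-1 *: grad phi x).

(* On Gamma, which is contained in the closure of Omega_minus, the matrix beta
   takes its limits from Omega_minus; the extension of its restriction to
   Omega_plus is another function gamma. *)
Definition piecewise_C1 (beta : 'rV[R]_n -> 'M[R]_n) : Prop :=
  forall i j, C1_closure Omega_minus (fun x => beta x i j) /\
    exists2 gamma, C1_closure Omega_plus gamma &
      forall x, Omega_plus x -> gamma x = beta x i j.

Definition elliptic_coef (m M : R) (beta : 'rV[R]_n -> 'M[R]_n) : Prop :=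
  forall x, Om x -> (beta x)^T = beta x /\
    forall xi, m * dotp xi xi <= mxdot (beta x) xi xi <= M * dotp xi xi.

End interface.

Section sobolev.
Context {R : realType} {n : nat}.
Local Notation mu := (lebesgue_rV R n).
Implicit Types (D : set 'rV[R]_n) (f eta : 'rV[R]_n -> R).

(* A Sobolev function is carried together with (a representative of) its weak
   gradient, which it determines almost everywhere. *)
Definition sobolev : Type :=
  (('rV[R]_n -> R^o) * ('rV[R]_n -> 'rV[R]_n))%type.
Implicit Types u v psi : sobolev.

Definition L2 D f : Prop :=
  measurable_fun D f /\ (\int[mu]_(x in D) ((f x) ^+ 2)%:E < +oo)%E.

Definition L1loc D f : Prop :=
  measurable_fun D f /\
  forall K, K `<=` D -> compact K -> (\int[mu]_(x in K) `|f x|%:E < +oo)%E.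

Definition test_fun D eta : Prop :=
  [/\ smooth_on setT eta,
      compact (closure [set x | eta x != 0]) &
      closure [set x | eta x != 0] `<=` D].

Definition weak_grad D f (w : 'rV[R]_n -> 'rV[R]_n) : Prop :=
  forall i eta, test_fun D eta ->
    \int[mu]_(x in D) (f x * partial i eta x) =
    - \int[mu]_(x in D) (w x ord0 i * eta x).

Definition weak_div D (X : 'rV[R]_n -> 'rV[R]_n) f : Prop :=
  [/\ forall i, L1loc D (fun x => X x ord0 i),
      L1loc D f &
      forall eta, test_fun D eta ->
        \int[mu]_(x in D) dotp (X x) (grad eta x) =
        - \int[mu]_(x in D) (f x * eta x)].

(* the weak divergence when it exists, the null function otherwise *)
Definition divergence D (X : 'rV[R]_n -> 'rV[R]_n) : 'rV[R]_n -> R :=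
  xget (cst 0) [set f | weak_div D X f].

Definition H1 D u : Prop :=
  [/\ L2 D u.1, forall i, L2 D (fun x => u.2 x ord0 i) & weak_grad D u.1 u.2].

Definition H1_norm D u : R :=
  Num.sqrt (\int[mu]_(x in D) ((u.1 x) ^+ 2 + dotp (u.2 x) (u.2 x))).

Definition of_test (eta : 'rV[R]_n -> R) : sobolev := (eta, grad eta).

(* closure of the test functions in H^1 *)
Definition H10 D u : Prop :=
  H1 D u /\ forall e : R, 0 < e ->
    exists2 eta, test_fun D eta & H1_norm D (u - of_test eta) < e.

Definition energy (beta : 'rV[R]_n -> 'M[R]_n) D u v : R :=
  \int[mu]_(x in D) mxdot (beta x) (u.2 x) (v.2 x).

Definition H10_norm beta D u : R := Num.sqrt (energy beta D u u).

Definition H10_dual beta D (l : sobolev -> R) : Prop :=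
  (forall (c : R) u v, H10 D u -> H10 D v -> l (c *: u + v) = c * l u + l v) /\
  exists C : R, forall u, H10 D u -> `|l u| <= C * H10_norm beta D u.

(* limits of families indexed by h > 0, as h tends to 0 *)
Definition strong_cvg beta D (U : R -> sobolev) u : Prop :=
  H10_norm beta D (U h - u) @[h --> 0^'+] --> (0 : R).

Definition weak_cvg beta D (U : R -> sobolev) u : Prop :=
  forall l, H10_dual beta D l -> l (U h) @[h --> 0^'+] --> l u.

Definition load beta Om phi (nu : 'rV[R]_n -> 'rV[R]_n) f
    (g a b : sobolev) psi : R :=
  let Omm := Omega_minus Om phi in
  \int[mu]_(x in Om) (f x * psi.1 x) + energy beta Om g psi
  - energy beta Omm a psi
  + \int[mu]_(x in Omm)
      divergence Omm (fun y => (b.1 y * psi.1 y) *: nu y) x.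

(* u - g + a \chi_{Omega^-}, with weak gradient w *)
Definition shifted Om phi (g a : sobolev) (u : 'rV[R]_n -> R)
    (w : 'rV[R]_n -> 'rV[R]_n) : sobolev :=
  ((fun x => u x - g.1 x + a.1 x * \1_(Omega_minus Om phi) x), w).

End sobolev.
Arguments sobolev : clear implicits.

Definition is_norm (R : realType) (V : lmodType R) (N : V -> R) : Prop :=
  [/\ forall x y, N (x + y) <= N x + N y,
      forall (c : R) x, N (c *: x) = `|c| * N x &
      forall x, N x = 0 -> x = 0].

(* Main.v *)
(* Coercivity makes the discrete problems uniquely solvable and bounds
   [T^h v^h] in H^1_0, so that every sequence h_k -> 0 has a subsequence along
   which [T^h v^h] converges weakly to some v. Off that subsequence, replace
   [v^h] by the approximations of v given by (ii): the resulting family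
   converges weakly to v, (v) applies to it, and in the limit
   - B[v, psi] = F(psi). This yields existence of v with no appeal to the
   linearity or continuity of F, and uniqueness of v turns subsequential weak
   convergence into weak convergence.
   The Hilbert space facts needed are those of (H^1_0, B): Poincare's
   inequality, completeness, Riesz representation and weak sequential
   compactness of balls. *)
Require Import Defs.
From HB Require Import structures.
From mathcomp Require Import all_boot all_order all_algebra.
From mathcomp Require Import all_classical all_reals all_analysis.
From mathcomp Require Import measurable_realfun.
From mathcomp Require Import ring lra.

Set Implicit Arguments.
Unset Strict Implicit.
Unset Printing Implicit Defensive.
Import Order.TTheory GRing.Theory Num.Theory.
Import numFieldNormedType.Exports.

Local Open Scope classical_set_scope.
Local Open Scope ring_scope.

(** * Complete semi-inner products *)

(** The functional [load] resists direct study: [divergence] is a choice among weak divergences with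
    a default value, so even its additivity in [psi] would first require a weak divergence of
    [b psi nu] to exist. Only hypothesis (v) gives access to its values, as limits of the linear
    functionals [Fh]. One abstract theory of complete, possibly degenerate forms on a subset of a
    module serves three times: for square integrable functions, for pairs of a function and a vector
    field with the H^1 product, and for [H10] with the energy. Each completeness statement is
    deduced from the preceding one. Degeneracy means that limits and representing vectors are
    determined only up to null vectors, which bounded functionals do not see. *)

Lemma quadratic_ge0_discr (R : realType) (a b e : R) : 0 <= a ->
  (forall t, 0 <= e + 2 * t * b + t ^+ 2 * a) -> b ^+ 2 <= a * e.
Proof.
rewrite le_eqVlt => /orP[/eqP <-|a0] H.
  have [->|b0] := eqVneq b 0; first by rewrite expr0n mul0r.
  (* With [a = 0] the polynomial is affine in [t]; at this point its value is -1. *)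
  have := H (- (e + 1) / (2 * b)).
  rewrite mulr0 addr0 (_ : 2 * _ * b = - (e + 1)); first lra.
  by field.
(* The minimizer of the quadratic. *)
have := H (- b / a).
rewrite (_ : _ + _ = (a * e - b ^+ 2) / a); last by field; rewrite gt_eqF.
by rewrite pmulr_lge0 ?invr_gt0// subr_ge0.
Qed.

(* [B u u] may vanish for [u != 0]: Sobolev functions are pairs of
   representatives. *)
Record semi_inner (R : realType) (E : lmodType R) (K : set E)
    (B : E -> E -> R) : Prop := SemiInner {
  si0 : K 0 ;
  siP : forall c u v, K u -> K v -> K (c *: u + v) ;
  siPl : forall c u v w, K u -> K v -> K w ->
    B (c *: u + v) w = c * B u w + B v w ;
  siC : forall u v, K u -> K v -> B u v = B v u ;
  si_ge0 : forall u, K u -> 0 <= B u u }.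

Definition complete_form (R : realType) (E : lmodType R) (K : set E)
    (B : E -> E -> R) : Prop :=
  forall u : nat -> E, (forall k, K (u k)) ->
  (forall e, 0 < e -> exists N, forall i j, (N <= i)%N -> (N <= j)%N ->
     B (u i - u j) (u i - u j) < e) ->
  exists2 p, K p & B (u k - p) (u k - p) @[k --> \oo] --> (0 : R).

Section semi_inner_theory.
Context (R : realType) (E : lmodType R) (K : set E) (B : E -> E -> R).
Hypothesis HB : semi_inner K B.
Implicit Types u v w : E.

Lemma siZ c u : K u -> K (c *: u).
Proof.
by move=> Ku; rewrite -[_ *: _]addr0; apply: (siP HB) => //; exact: (si0 HB).
Qed.

Lemma siD u v : K u -> K v -> K (u + v).
Proof. by move=> *; rewrite -[u]scale1r; exact: (siP HB). Qed.

Lemma siB u v : K u -> K v -> K (u - v).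
Proof. by move=> *; rewrite addrC -scaleN1r; exact: (siP HB). Qed.

Lemma siDl u v w : K u -> K v -> K w -> B (u + v) w = B u w + B v w.
Proof. by move=> *; rewrite -[u]scale1r (siPl HB)// scale1r mul1r. Qed.

Lemma si0l w : K w -> B 0 w = 0.
Proof.
by move=> Kw; have := siDl (si0 HB) (si0 HB) Kw; rewrite addr0; lra.
Qed.

Lemma siZl c u w : K u -> K w -> B (c *: u) w = c * B u w.
Proof.
move=> Ku Kw; rewrite -[c *: u]addr0 (siPl HB)//; last exact: (si0 HB).
by rewrite si0l// addr0.
Qed.

Lemma siBl u v w : K u -> K v -> K w -> B (u - v) w = B u w - B v w.
Proof. by move=> *; rewrite addrC -scaleN1r (siPl HB)//; ring. Qed.

Lemma siBr u v w : K u -> K v -> K w -> B w (u - v) = B w u - B w v.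
Proof.
move=> Ku Kv Kw; rewrite (siC HB Kw (siB Ku Kv)) siBl//.
by rewrite (siC HB Kw Ku) (siC HB Kw Kv).
Qed.

Lemma siDr u v w : K u -> K v -> K w -> B w (u + v) = B w u + B w v.
Proof.
move=> Ku Kv Kw; rewrite (siC HB Kw (siD Ku Kv)) siDl//.
by rewrite (siC HB Kw Ku) (siC HB Kw Kv).
Qed.

Lemma siZr c u w : K u -> K w -> B w (c *: u) = c * B w u.
Proof.
by move=> Ku Kw; rewrite (siC HB Kw (siZ c Ku)) siZl// (siC HB Kw Ku).
Qed.

Lemma si_sqrP t u v : K u -> K v ->
  B (u + t *: v) (u + t *: v) = B u u + 2 * t * B u v + t ^+ 2 * B v v.
Proof.
move=> Ku Kv; have Ktv := siZ t Kv; have Kutv := siD Ku Ktv.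
rewrite siDl// !siDr// siZl// siZr// siZl// siZr// (siC HB Kv Ku); ring.
Qed.

Lemma si_sqrB u v : K u -> K v ->
  B (u - v) (u - v) = B u u - 2 * B u v + B v v.
Proof. by move=> *; rewrite -scaleN1r si_sqrP//; ring. Qed.

Lemma si_CS u v : K u -> K v -> B u v ^+ 2 <= B u u * B v v.
Proof.
move=> Ku Kv; rewrite mulrC; apply: quadratic_ge0_discr => [|t].
  exact: (si_ge0 HB).
rewrite -si_sqrP//; apply: (si_ge0 HB) => //.
by apply: siD => //; exact: siZ.
Qed.

Lemma si_CS_sqrt u v : K u -> K v ->
  `|B u v| <= Num.sqrt (B u u) * Num.sqrt (B v v).
Proof.
move=> Ku Kv; rewrite -sqrtrM; last exact: (si_ge0 HB).
by rewrite -sqrtr_sqr ler_wsqrtr// si_CS.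
Qed.

Lemma si_normD u v : K u -> K v ->
  Num.sqrt (B (u + v) (u + v)) <= Num.sqrt (B u u) + Num.sqrt (B v v).
Proof.
move=> Ku Kv.
have s0 : 0 <= Num.sqrt (B u u) + Num.sqrt (B v v) by rewrite addr_ge0 ?sqrtr_ge0.
rewrite -[leRHS]ger0_norm// -sqrtr_sqr ler_wsqrtr//.
have := si_sqrP 1 Ku Kv; rewrite scale1r => ->.
have := ler_norml (B u v) (Num.sqrt (B u u) * Num.sqrt (B v v)).
rewrite si_CS_sqrt// => /esym/andP[_].
have := sqr_sqrtr (si_ge0 HB Ku); have := sqr_sqrtr (si_ge0 HB Kv).
nra.
Qed.

(** Cauchy-Schwarz: strong convergence implies weak convergence. *)
Lemma si_cvgl (x : nat -> E) p r : (forall k, K (x k)) -> K p -> K r ->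
  B (x k - p) (x k - p) @[k --> \oo] --> (0 : R) ->
  B (x k) r @[k --> \oo] --> B p r.
Proof.
move=> Kx Kp Kr xp; apply/cvgrPdist_le => e e0.
(* The summand 1 keeps the divisor positive when [r] is a null vector. *)
pose c := B r r + 1.
have c0 : 0 < c by rewrite ltr_wpDl// (si_ge0 HB).
have : \forall k \near \oo, B (x k - p) (x k - p) < e ^+ 2 / c.
  by apply: (cvgr_lt 0) => //; rewrite divr_gt0// exprn_gt0.
apply: filterS => k xk.
rewrite distrC -siBl// -ler_sqr ?nnegrE; [|exact: normr_ge0|exact: ltW].
rewrite real_normK ?num_real//.
have xpK := siB (Kx k) Kp.
apply: (le_trans (si_CS xpK Kr)).
have -> : e ^+ 2 = e ^+ 2 / c * c by field; rewrite gt_eqF.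
by apply: ler_pM; [exact: (si_ge0 HB)|exact: (si_ge0 HB)|exact: ltW|rewrite lerDl].
Qed.

Hypothesis HC : complete_form K B.

(* [p] is the limit of a minimizing sequence [w] of [B x x - 2 l x] on [W].
   [W] need not be closed, so that [p] need not lie in [W]. *)
Lemma riesz_on (W : set E) (l : E -> R) (C : R) :
  W `<=` K -> W 0 -> (forall c u v, W u -> W v -> W (c *: u + v)) ->
  (forall c u v, W u -> W v -> l (c *: u + v) = c * l u + l v) ->
  (forall u, W u -> `|l u| <= C * Num.sqrt (B u u)) ->
  exists p (w : nat -> E), [/\ K p, forall k, W (w k),
    B (w k - p) (w k - p) @[k --> \oo] --> (0 : R) &
    forall x, W x -> B p x = l x].
Proof.
move=> WK W0 WP lP lC.
have WB u v : W u -> W v -> W (u - v).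
  by move=> Wu Wv; rewrite addrC -scaleN1r; exact: WP.
pose J x := B x x - 2 * l x.
(* With [s] the norm of [x], [J x] is at least [s^2 - 2 C s = (s - C)^2 - C^2]. *)
have Jlb x : W x -> - C ^+ 2 <= J x.
  move=> Wx; have := lC x Wx; have := ler_norm (l x).
  have := sqr_sqrtr (si_ge0 HB (WK _ Wx)); rewrite /J.
  set s := Num.sqrt _ => <- h1 h2; have := sqr_ge0 (s - C); nra.
pose S := J @` W.
have hS : has_inf S.
  split; first by exists (J 0), 0.
  by exists (- C ^+ 2) => _ [x Wx <-]; exact: Jlb.
have /choice[w wP] k : exists w, W w /\ J w < inf S + k.+1%:R^-1.
  have k0 : 0 < k.+1%:R^-1 :> R by rewrite invr_gt0.
  have [_ [x Wx <-] Jx] := inf_adherent k0 hS.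
  by exists x.
(* An approximate Euler equation: [J (w k + t x) - J (w k) + 1/(k+1)] is a quadratic in [t] that is
   nowhere negative, and this is its discriminant inequality. *)
have key k x : W x -> (B (w k) x - l x) ^+ 2 <= B x x * k.+1%:R^-1.
  move=> Wx; have [Ww Jw] := wP k.
  apply: quadratic_ge0_discr => [|t]; first exact: (si_ge0 HB (WK _ Wx)).
  have Wt : W (w k + t *: x) by rewrite addrC; exact: WP.
  have : inf S <= J (w k + t *: x).
    by apply: ge_inf; [exact: hS.2|exists (w k + t *: x)].
  rewrite /J si_sqrP; [|exact: WK..].
  have -> : l (w k + t *: x) = t * l x + l (w k) by rewrite addrC lP.
  by move: Jw; rewrite /J; move: (inf S) (k.+1%:R^-1) => d e; lra.
(* Apply [key] to [w i - w j] itself: its square norm [D] is the difference of the two residuals [p]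
   and [q], so [D^2 <= 2 (p^2 + q^2)] is at most [D] times the right-hand side, and [D] cancels. *)
have cauchy i j : B (w i - w j) (w i - w j) <= 2 * (i.+1%:R^-1 + j.+1%:R^-1).
  have Wi := (wP i).1; have Wj := (wP j).1; have Wij := WB _ _ Wi Wj.
  have := key i _ Wij; have := key j _ Wij.
  have := si_ge0 HB (WK _ Wij).
  have : B (w i - w j) (w i - w j) =
     (B (w i) (w i - w j) - l (w i - w j)) - (B (w j) (w i - w j) - l (w i - w j)).
    by rewrite {1}siBl; [ring|exact: WK..].
  set D := B (w i - w j) _; set p := (X in X - _); set q := (X in _ - X).
  move=> Dpq; rewrite le_eqVlt => /orP[/eqP <- _ _|D0 hj hi].
    by rewrite mulr_ge0// addr_ge0// invr_ge0.
  rewrite -(ler_pM2l D0).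
  have -> : D * D = (p - q) ^+ 2 by rewrite -Dpq expr2.
  have aux (a b d e1 e2 : R) : a ^+ 2 <= d * e1 -> b ^+ 2 <= d * e2 ->
      (a - b) ^+ 2 <= d * (2 * (e1 + e2)).
    by have := sqr_ge0 (a + b); lra.
  exact: aux.
have [k|e e0|p Kp wp] := HC (u := w).
- exact: WK (wP k).1.
- have : \forall k \near \oo, k.+1%:R^-1 < e / 4.
    by apply: near_infty_natSinv_lt (PosNum (divr_gt0 e0 (ltr0n _ 4))).
  move=> [N _ NP]; exists N => i j Ni Nj.
  apply: le_lt_trans (cauchy i j) _.
  have : i.+1%:R^-1 < e / 4 := NP i Ni; have : j.+1%:R^-1 < e / 4 := NP j Nj.
  by move: (i.+1%:R^-1) (j.+1%:R^-1) => a b; lra.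
exists p, w; split => //; first by move=> k; exact: (wP k).1.
(* In the limit the approximate Euler equation [key] becomes exact. *)
move=> x Wx.
have c1 : B (w k) x - l x @[k --> \oo] --> B p x - l x.
  apply: cvgB; last exact: cvg_cst.
  by apply: si_cvgl => //; [move=> k; exact: WK (wP k).1|exact: WK].
have c2 : (B (w k) x - l x) ^+ 2 @[k --> \oo] --> (B p x - l x) ^+ 2.
  by rewrite expr2; under eq_fun do rewrite expr2; exact: cvgM.
have c3 : B x x * k.+1%:R^-1 @[k --> \oo] --> B x x * 0.
  by apply: cvgMr; exact: cvg_harmonic.
have : (B p x - l x) ^+ 2 <= B x x * 0.
  apply: (ler_cvg_to c2 c3); near=> k; exact: key.
by rewrite mulr0 exprn_even_le0//= subr_eq0 => /eqP.
Unshelve. all: by end_near. Qed.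

(** Weak sequential compactness of balls with no dense sequence at hand: along an ultrafilter the
    products with all vectors converge at once, and the Riesz representation turns their limits into
    a vector. What remains is to trade the ultrafilter for a subsequence. *)
Lemma weak_subsequence (u : nat -> E) (C : R) :
  (forall k, K (u k)) -> (forall k, B (u k) (u k) <= C) ->
  exists (s : nat -> nat) (v : E), [/\ K v, forall j, (j <= s j)%N &
    forall r, K r -> B (u (s j)) r @[j --> \oo] --> B v r].
Proof.
move=> Ku uC.
have [G [GU sG]] := ultraFilterLemma (@eventually_filter : ProperFilter \oo).
have GF : ProperFilter G by exact: ultra_proper.
pose c r := Num.sqrt C * Num.sqrt (B r r).
have bnd k r : K r -> `|B (u k) r| <= c r.
  move=> Kr; apply: le_trans (si_CS_sqrt (Ku k) Kr) _.
  by rewrite ler_wpM2r ?sqrtr_ge0// ler_wsqrtr.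
have /choice[L LP] : forall r, exists y : R, K r -> B (u k) r @[k --> G] --> y.
  move=> r; have [Kr|nKr] := pselect (K r); last by exists 0.
  (* The values stay in a compact segment, so they have a cluster point along [G]; for an
     ultrafilter a cluster point is a limit. *)
  have xG : ((fun k => B (u k) r) @ G) `[- c r, c r]%classic.
    by apply: (@nearW _ G) => k /=; rewrite in_itv/= -ler_norml bnd.
  have [y [_ cly]] := @segment_compact _ _ _ _ (fmap_proper_filter _ GF) xG.
  exists y => _ U yU.
  have [//|nU] := in_ultra_setVsetC ((fun k => B (u k) r) @^-1` U) GU.
  by have [z [/= nz Uz]] := cly (~` U) U nU yU.
have L_lin c' x y : K x -> K y -> L (c' *: x + y) = c' * L x + L y.
  move=> Kx Ky; have Kxy := siP HB c' Kx Ky.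
  apply: (cvg_unique _ (LP _ Kxy)) => //.
  rewrite (_ : (fun k => B (u k) (c' *: x + y)) =
               (fun k => c' * B (u k) x + B (u k) y)).
    by apply: cvgD; [apply: cvgMr; exact: LP|exact: LP].
  by apply/funext => k; rewrite siDr ?siZr//; exact: siZ.
have Lc x : K x -> `|L x| <= c x.
  move=> Kx; apply: (ler_cvg_to (cvg_norm (LP x Kx)) (cvg_cst (c x))).
  by apply: (@nearW _ G) => k; exact: bnd.
(* A weak limit along the ultrafilter [G]; the subsequence is then chosen so as
   to control the countably many vectors [u i] and [v]. *)
have [v [_ [Kv _ _ vL]]] :=
  riesz_on (@subset_refl _ K) (si0 HB) (siP HB) L_lin Lc.
have /choice[s sP] j : exists k, (j <= k)%N /\
    (forall i, (i <= j)%N -> `|B (u k) (u i) - B v (u i)| < j.+1%:R^-1) /\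
    `|B (u k) v - B v v| < j.+1%:R^-1.
  have j0 : 0 < j.+1%:R^-1 :> R by rewrite invr_gt0.
  have near_r r : K r -> \forall k \near G, `|B (u k) r - B v r| < j.+1%:R^-1.
    move=> Kr; rewrite vL//; have /cvgrPdist_lt/(_ _ j0) := LP r Kr.
    by apply: filterS => k; rewrite distrC.
  have G1 : \forall k \near G, (j <= k)%N by apply: sG; exact: nbhs_infty_ge.
  have G2 : \forall k \near G, forall i : 'I_j.+1,
      `|B (u k) (u i) - B v (u i)| < j.+1%:R^-1.
    by apply: filter_forall => i; exact: near_r.
  apply: (@filter_ex _ G); apply: filterS3 G1 G2 (near_r v Kv) => k k1 k2 k3.
  by split => //; split => // i ij; exact: (k2 (@Ordinal j.+1 i ij)).
exists s, v; split => //; first by move=> j; exact: (sP j).1.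
pose x j := u (s j) - v.
(* [W] is a closed subspace containing every [x j]; hence [B (x j) r] only
   depends on the projection [p] of [r] to [W]. *)
have Kx j : K (x j) by exact: siB.
pose W := [set r | K r /\ B (x j) r @[j --> \oo] --> (0 : R)].
have Wsub : W `<=` K by move=> r [].
have W0 : W 0.
  split; first exact: si0 HB.
  rewrite (_ : (fun j => B (x j) 0) = cst 0); first exact: cvg_cst.
  by apply/funext => j; rewrite (siC HB (Kx _) (si0 HB)) si0l.
have WP c' a b : W a -> W b -> W (c' *: a + b).
  move=> [Ka xa] [Kb xb]; split; first exact: (siP HB).
  rewrite (_ : (fun j => _) = (fun j => c' * B (x j) a + B (x j) b)); last first.
    by apply/funext => j; rewrite siDr ?siZr//; exact: siZ.
  rewrite -[0]addr0 -[X in X + _](mulr0 c').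
  by apply: cvgD => //; exact: cvgMr.
have squeeze (z : nat -> R) N : (forall j, (N <= j)%N -> `|z j| < j.+1%:R^-1) ->
    z j @[j --> \oo] --> (0 : R).
  move=> zN; apply/cvgr0Pnorm_lt => e e0; near=> j.
  apply: (lt_trans (zN j _)); first by near: j; exact: nbhs_infty_ge.
  by near: j; exact: near_infty_natSinv_lt (PosNum e0).
have WB a b : W a -> W b -> W (a - b).
  by move=> Wa Wb; rewrite addrC -scaleN1r; exact: WP.
have Wv : W v.
  split => //; apply: (squeeze _ 0%N) => j _.
  by rewrite siBl//; exact: (sP j).2.2.
(* The choice of [s j] controls [u i] only when [i <= j], hence the threshold [i]. *)
have Wu i : W (u i).
  split => //; apply: (squeeze _ i) => j ij.
  by rewrite siBl//; exact: (sP j).2.1.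
have Wx i : W (x i) by exact: WB.
(* The parallelogram identity bounds the square norm of [u (s j) - v] by [2 (C + B v v)]; the 1
   makes [D] a legitimate divisor. *)
pose D := 2 * (C + B v v) + 1.
have xD j : B (x j) (x j) <= D.
  have := si_ge0 HB (siD (Ku (s j)) Kv).
  have := @si_sqrP 1 (u (s j)) v (Ku _) Kv; rewrite scale1r => ->.
  by rewrite si_sqrB// /D; have := uC (s j); lra.
have D0 : 0 < D.
  have C0 := le_trans (si_ge0 HB (Ku 0%N)) (uC 0%N).
  by rewrite /D ltr_wpDl// mulr_ge0// addr_ge0// (si_ge0 HB).
move=> r Kr.
suff xr : B (x j) r @[j --> \oo] --> (0 : R).
  rewrite (_ : (fun j => B (u (s j)) r) = (fun j => B (x j) r + B v r)).
    by rewrite -[X in _ --> X]add0r; apply: cvgD => //; exact: cvg_cst.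
  by apply/funext => j; rewrite siBl// subrK.
have [||p [w [Kp Ww wp pr]]] := @riesz_on W (B r) (Num.sqrt (B r r)) Wsub W0 WP.
- move=> c' a b [Ka _] [Kb _]; rewrite siDr ?siZr//; exact: siZ.
- by move=> a [Ka _]; exact: si_CS_sqrt.
rewrite (_ : (fun j => B (x j) r) = (fun j => B (x j) p)); last first.
  by apply/funext => j; rewrite (siC HB (Kx j) Kr) -pr// (siC HB Kp (Kx j)).
apply/cvgr0Pnorm_le => e e0.
(* Since [p] is only known to be a limit of members of [W], replace it by a close [w k]. The error
   [B (x j) (w k - p)] is at most [e / 2] uniformly in [j], because [B (x j) (x j) <= D]. *)
have [k wk] : exists k, B (w k - p) (w k - p) < (e / 2) ^+ 2 / D.
  have /filter_ex// : \forall k \near \oo,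
      B (w k - p) (w k - p) < (e / 2) ^+ 2 / D.
  by apply: (cvgr_lt 0 wp); rewrite divr_gt0// exprn_gt0// divr_gt0.
have [Kw xw] := Ww k.
have e20 : 0 < e / 2 by rewrite divr_gt0.
move/cvgr0Pnorm_lt : xw => /(_ _ e20); apply: filterS => j xjw.
have -> : B (x j) p = B (x j) (w k) - B (x j) (w k - p) by rewrite siBr//; ring.
rewrite (splitr e); apply: (le_trans (ler_normB _ _)).
apply: lerD; first exact: ltW.
rewrite -ler_sqr ?nnegrE//; last exact: ltW.
have Kwp := siB Kw Kp.
rewrite real_normK ?num_real//; apply: (le_trans (si_CS (Kx j) Kwp)).
rewrite (_ : (e / 2) ^+ 2 = D * ((e / 2) ^+ 2 / D)); last by field; rewrite gt_eqF.
by apply: ler_pM; [exact: (si_ge0 HB)|exact: (si_ge0 HB)|exact: xD|exact: ltW].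
Unshelve. all: by end_near. Qed.

End semi_inner_theory.

(** * The space of square integrable functions *)

Section L2_theory.
Context {R : realType} {n : nat}.
Local Notation mu := (lebesgue_rV R n).
Variable D : set 'rV[R]_n.
Hypothesis mD : measurable D.
Implicit Types f g : 'rV[R]_n -> R.

(** The product is dominated by [f^2 + g^2]. *)
Lemma L2_mul_integrable f g : L2 D f -> L2 D g ->
  mu.-integrable D (EFin \o (fun x => f x * g x)).
Proof.
move=> [mf If] [mg Ig].
have sq (h : _ -> R) : measurable_fun D h ->
    measurable_fun D (fun x => ((h x) ^+ 2)%:E).
  by move=> mh; apply/measurable_EFinP; exact: measurable_funX.
apply/integrableP; split.
  by apply/measurable_EFinP; exact: measurable_funM.
apply: (@le_lt_trans _ _
   (\int[mu]_(x in D) (((f x) ^+ 2)%:E + ((g x) ^+ 2)%:E)%E)%E).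
  apply: ge0_le_integral => //.
  - apply/measurable_EFinP; apply: measurableT_comp => //.
    exact: measurable_funM.
  - by apply: emeasurable_funD; exact: sq.
  - move=> x _; rewrite /= lee_fin ler_norml.
    have := sqr_ge0 (f x + g x); have := sqr_ge0 (f x - g x).
    have := sqr_ge0 (f x); have := sqr_ge0 (g x).
    by move=> *; apply/andP; split; lra.
rewrite ge0_integralD//.
- by rewrite lte_add_pinfty.
- by move=> x _; rewrite lee_fin sqr_ge0.
- exact: sq.
- by move=> x _; rewrite lee_fin sqr_ge0.
- exact: sq.
Qed.

Lemma L2_integrable_sqr f : L2 D f ->
  mu.-integrable D (EFin \o (fun x => f x * f x)).
Proof. by move=> *; exact: L2_mul_integrable. Qed.

Lemma L2_intro f : measurable_fun D f ->
  mu.-integrable D (EFin \o (fun x => f x * f x)) -> L2 D f.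
Proof.
by move=> mf /integrable_lty => /(_ mD) If; split.
Qed.

Lemma L2_lin (c : R) f g : L2 D f -> L2 D g -> L2 D (fun x => c * f x + g x).
Proof.
move=> Lf Lg; apply: L2_intro.
  apply: measurable_funD; last exact: Lg.1.
  by apply: measurable_funM => //; exact: Lf.1.
have ff := L2_mul_integrable Lf Lf; have fg := L2_mul_integrable Lf Lg.
have gg := L2_mul_integrable Lg Lg.
have := integrableD mD (integrableD mD (integrableZl mD (c ^+ 2) ff)
  (integrableZl mD (2 * c) fg)) gg.
apply: eq_integrable => // x _ /=; rewrite -!EFinM -!EFinD; congr EFin; ring.
Qed.

Lemma L2_0 : L2 D (cst 0).
Proof.
split; first exact: measurable_cst.
by under eq_integral do rewrite /= expr0n/=; rewrite integral0.
Qed.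

Definition L2_dot f g : R := \int[mu]_(x in D) (f x * g x).

Lemma L2_semi_inner : @semi_inner R ('rV[R]_n -> R^o) (L2 D) L2_dot.
Proof.
split.
- exact: L2_0.
- by move=> c f g Lf Lg; exact: L2_lin.
- move=> c f g h Lf Lg Lh; rewrite /L2_dot.
  rewrite -RintegralZl//; last exact: L2_mul_integrable.
  rewrite -RintegralD//; last exact: L2_mul_integrable.
    by apply: eq_Rintegral => x _; rewrite /= mulrDl mulrA.
  by apply: (integrableZl mD c (L2_mul_integrable Lf Lh)).
- by move=> f g _ _; apply: eq_Rintegral => x _; rewrite mulrC.
- by move=> f _; apply: Rintegral_ge0 => x _; rewrite -expr2 sqr_ge0.
Qed.

Lemma L2_dotE f : L2 D f ->
  (L2_dot f f)%:E = (\int[mu]_(x in D) ((f x) ^+ 2)%:E)%E.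
Proof.
move=> Lf; rewrite /L2_dot /Rintegral fineK.
  by apply: eq_integral => x _; rewrite expr2.
exact: (integrable_fin_num mD (L2_integrable_sqr Lf)).
Qed.

Lemma L2_dot_eq0 f : L2 D f -> L2_dot f f = 0 ->
  {ae mu, forall x, D x -> f x = 0}.
Proof.
move=> Lf f0.
have m2 : measurable_fun D (fun x => ((f x) ^+ 2)%:E).
  by apply/measurable_EFinP; apply: measurable_funX; exact: Lf.1.
have : ae_eq mu D (fun x => ((f x) ^+ 2)%:E) (cst 0%E).
  apply/(ae_eq_integral_abs mu mD m2).
  under eq_integral => x _ do rewrite gee0_abs ?lee_fin ?sqr_ge0//.
  by rewrite -L2_dotE// f0.
apply: filterS => x + Dx => /(_ Dx) [] /eqP.
by rewrite sqrf_eq0 => /eqP.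
Qed.

End L2_theory.

(** * Completeness of the square integrable functions (Riesz-Fischer) *)

Lemma limn_einf_near_le (R : realType) (u : (\bar R)^nat) (c : \bar R) :
  (\forall k \near \oo, (u k <= c)%E) -> (limn_einf u <= c)%E.
Proof.
move=> [K _ Kc]; rewrite limn_einf_lim.
apply: lime_le; first exact: is_cvg_einfs.
apply: nearW => k; rewrite /einfs.
apply: (le_trans _ (Kc (maxn k K) (leq_maxr _ _))).
by apply: ereal_inf_lbound; exists (maxn k K) => //=; exact: leq_maxl.
Qed.

Lemma nneseries_geometric_lty (R : realType) (a : (\bar R)^nat) (c : R) :
  (forall k, (0 <= a k <= (c * 2^-1 ^+ k)%:E)%E) ->
  (\sum_(0 <= k <oo) a k < +oo)%E.
Proof.
move=> ac.
have c0 : 0 <= c.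
  have /andP[a0 a1] := ac 0%N.
  by have := le_trans a0 a1; rewrite lee_fin expr0 mulr1.
apply: (@le_lt_trans _ _ (2 * c)%:E); last exact: ltry.
apply: lime_le.
  by apply: is_cvg_nneseries => k _ _; have /andP[] := ac k.
apply: nearW => k.
apply: (@le_trans _ _ (\sum_(0 <= i < k) (c * 2^-1 ^+ i)%:E)%E).
  by apply: lee_sum => i _; have /andP[] := ac i.
rewrite sumEFin lee_fin.
suff -> : \sum_(0 <= i < k) c * 2^-1 ^+ i = 2 * c - 2 * c * 2^-1 ^+ k.
  by rewrite lerBlDr lerDl mulr_ge0 ?mulr_ge0.
elim: k => [|k IH]; first by rewrite big_nil expr0; ring.
by rewrite big_nat_recr//= IH exprS; field.
Qed.

Section Riesz_Fischer.
Context {R : realType} {n : nat}.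
Local Notation mu := (lebesgue_rV R n).
Variable D : set 'rV[R]_n.
Hypothesis mD : measurable D.
Hypothesis Doo : (mu D < +oo)%E.
Implicit Types f g : 'rV[R]_n -> R.
Local Notation L2s := (@L2_semi_inner R n D mD).

(** Integrate [|f| <= a + f^2 / a], a consequence of [(|f| - a)^2 >= 0]. The parameter [a] is to be
    matched to the size of [f]. *)
Lemma L2_abs_integral_le f (a : R) : L2 D f -> 0 < a ->
  (\int[mu]_(x in D) `|f x|%:E <=
     (a * fine (mu D) + a^-1 * L2_dot D f f)%:E)%E.
Proof.
move=> Lf a0.
have m2 : measurable_fun D (fun x => (f x * f x)%:E).
  by apply/measurable_EFinP; apply: measurable_funM; exact: Lf.1.
have -> : (a * fine (mu D) + a^-1 * L2_dot D f f)%:E =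
    (\int[mu]_(x in D) (a%:E + a^-1%:E * (f x * f x)%:E))%E.
  rewrite ge0_integralD//; last first.
  - by apply: emeasurable_funM => //.
  - by move=> x _; apply: mule_ge0; rewrite lee_fin;
      [rewrite invr_ge0 ltW|rewrite -expr2 sqr_ge0].
  - by move=> x _; rewrite lee_fin ltW.
  rewrite integral_cst// ge0_integralZl_EFin ?invr_ge0 ?ltW//; last first.
    by move=> x _; rewrite lee_fin -expr2 sqr_ge0.
  rewrite EFinD !EFinM fineK ?ge0_fin_numE// (L2_dotE mD Lf).
  by under [in RHS]eq_integral do rewrite -expr2.
apply: ge0_le_integral => //.
- by apply/measurable_EFinP; apply: measurableT_comp => //; exact: Lf.1.
- by apply: emeasurable_funD => //; apply: emeasurable_funM.
- move=> x _; rewrite -EFinM -EFinD lee_fin.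
  have : 0 <= (`|f x| - a) ^+ 2 by exact: sqr_ge0.
  have -> : f x * f x = `|f x| ^+ 2 by rewrite real_normK ?num_real// expr2.
  move=> h; have := normr_ge0 (f x); move: h; move: `|f x| => t h t0.
  rewrite -(ler_pM2l a0) mulrDr mulrA divff ?gt_eqF// mul1r.
  nra.
Qed.

(** The series of the absolute increments has a finite integral, so it is finite almost everywhere,
    and there the telescoping series converges. *)
Lemma L2_ae_cvg (u : nat -> 'rV[R]_n -> R^o) :
  (forall k, L2 D (u k)) ->
  (forall k, L2_dot D (u k.+1 - u k) (u k.+1 - u k) <= 4^-1 ^+ k) ->
  {ae mu, forall x, D x -> cvgn (u ^~ x)}.
Proof.
move=> Lu hu.
pose d k := u k.+1 - u k.
have Ld k : L2 D (d k) by exact: (siB L2s).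
have md k : measurable_fun D (fun x => `|d k x|%:E).
  by apply/measurable_EFinP; apply: measurableT_comp => //; exact: (Ld k).1.
pose G x := (\sum_(0 <= k <oo) `|d k x|%:E)%E.
have intG : mu.-integrable D G.
  have mG : measurable_fun D G by exact: ge0_emeasurable_sum.
  apply/integrableP; split => //.
  under eq_integral => x _ do rewrite gee0_abs ?nneseries_ge0//.
  rewrite integral_nneseries//.
  apply: (@nneseries_geometric_lty _ _ (fine (mu D) + 1)) => k.
  rewrite integral_ge0//=.
  (* The weight [a = 2^-k] balances the two terms: [a^-1 4^-k = 2^-k] as well, so the k-th integral
     is at most [(mu D + 1) 2^-k]. *)
  have h0 : 0 < 2^-1 ^+ k :> R by rewrite exprn_gt0.
  apply: (le_trans (L2_abs_integral_le (Ld k) h0)).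
  rewrite lee_fin mulrDl mul1r mulrC lerD2l.
  rewrite ler_pdivrMl// -exprMn; apply: (le_trans (hu k)).
  by rewrite -invfM -natrM.
have := integrable_ae mD intG; apply: filterS => x + Dx => /(_ Dx) Gx.
have : cvgn [normed series (fun k => (d k x : R^o))].
  apply: nnseries_is_cvg => [k /=|]; first exact: normr_ge0.
  rewrite -/(G x) -ge0_fin_numE//.
  by apply: nneseries_ge0 => k _ _; rewrite lee_fin.
move=> /normed_cvg cs.
rewrite (_ : u^~ x = (fun k => u 0%N x + series (fun k => d k x) k)).
  by apply: is_cvgD => //; exact: is_cvg_cst.
by apply/funext => k; rewrite (eq_sum_telescope (u^~ x)).
Qed.

Lemma L2_complete : @complete_form R ('rV[R]_n -> R^o) (L2 D) (L2_dot D).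
Proof.
move=> u Lu cu.
have /choice[N NP] k : exists N, forall i j, (N <= i)%N -> (N <= j)%N ->
    L2_dot D (u i - u j) (u i - u j) < 4^-1 ^+ k.
  by apply: cu; rewrite exprn_gt0.
(* Summing the thresholds yields [s k >= N k], and the successors make [s] strictly increasing. *)
pose s k := (\sum_(i < k.+1) (N i).+1)%N.
have sN k : (N k <= s k)%N.
  by rewrite /s big_ord_recr/=; apply: leq_trans (leqnSn _) (leq_addl _ _).
have sS k : (s k < s k.+1)%N.
  by rewrite /s [X in (_ < X)%N]big_ord_recr/= addnS ltnS leq_addr.
have sk k : (k <= s k)%N by elim: k => // k IH; exact: leq_ltn_trans IH (sS k).
have aecvg : {ae mu, forall x, D x -> cvgn (fun k => u (s k) x)}.
  apply: (@L2_ae_cvg (fun k => u (s k))) => // k.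
  apply/ltW/NP => //; apply: leq_trans (sN k) _; exact: ltnW.
(* The upper limit is measurable on all of [D] and is the limit wherever one exists; [fine] replaces
   infinite values by 0. *)
pose p : 'rV[R]_n -> R^o := fun x => fine (limn_esup (fun k => (u (s k) x)%:E)).
have mp : measurable_fun D p.
  apply: (measurableT_comp (@fine_measurable _ _ _)) => //.
  by apply: measurable_fun_limn_esup => k; apply/measurable_EFinP; exact: (Lu _).1.
have msub i : measurable_fun D (fun x => ((u i x - p x) ^+ 2)%:E).
  apply/measurable_EFinP; apply: measurable_funX; apply: measurable_funB => //.
  exact: (Lu _).1.
(* Fatou's lemma along the subsequence [s], with the index [i] held fixed. *)
have key (e : R) M : 0 < e ->
    (forall i j, (M <= i)%N -> (M <= j)%N ->
      L2_dot D (u i - u j) (u i - u j) < e) ->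
    forall i, (M <= i)%N -> (\int[mu]_(x in D) ((u i x - p x) ^+ 2)%:E <= e%:E)%E.
  move=> e0 hM i Mi.
  pose v k x := ((u i x - u (s k) x) ^+ 2)%:E.
  have mv k : measurable_fun D (v k).
    apply/measurable_EFinP; apply: measurable_funX; apply: measurable_funB => //.
      exact: (Lu i).1.
    exact: (Lu (s k)).1.
  have v0 k x : D x -> (0 <= v k x)%E by move=> _; rewrite lee_fin sqr_ge0.
  have -> : (\int[mu]_(x in D) ((u i x - p x) ^+ 2)%:E)%E =
            (\int[mu]_(x in D) limn_einf (v^~ x))%E.
    apply: ae_eq_integral => //.
      under eq_fun do rewrite -[limn_einf _]oppeK -limn_esupN.
      apply: measurableT_comp => //; apply: measurable_fun_limn_esup => k.
      exact: (measurableT_comp (f := -%E) _ (mv k)).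
    move: aecvg; apply: filterS => x + Dx => /(_ Dx) cx.
    have px : u (s k) x @[k --> \oo] --> p x.
      have cE : (u (s k) x)%:E @[k --> \oo] --> (limn (fun k => u (s k) x))%:E.
        by apply: cvg_EFin => //; exact: nearW.
      have -> // : p x = limn (fun k => u (s k) x).
      rewrite /p is_cvg_limn_esupE; last by apply/cvg_ex; eexists; exact: cE.
      by rewrite (cvg_lim _ cE).
    have cv : v k x @[k --> \oo] --> ((u i x - p x) ^+ 2)%:E.
      apply: cvg_EFin; first exact: nearW.
      by rewrite !expr2; apply: cvgM; (apply: cvgB => //; exact: cvg_cst).
    rewrite is_cvg_limn_einfE; last by apply/cvg_ex; eexists; exact: cv.
    by rewrite (cvg_lim _ cv).
  apply: (le_trans (fatou mu mD mv v0)).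
  apply: limn_einf_near_le; exists M => // k /= Mk.
  rewrite -L2_dotE//; last exact: (siB L2s).
  by rewrite lee_fin; apply/ltW/hM => //; exact: leq_trans Mk (sk k).
(* By [key] with [e = 1], [u M - p] is square integrable, hence so is [p]. *)
have Lp : L2 D p.
  have [M hM] := cu 1 ltr01.
  have Lup : L2 D (u M - p).
    split; first by apply: measurable_funB => //; exact: (Lu M).1.
    by apply: le_lt_trans (key _ _ ltr01 hM M (leqnn M)) (ltry _).
  rewrite (_ : p = u M - (u M - p)); last by rewrite subKr.
  exact: (siB L2s).
exists p => //; apply/cvgr0Pnorm_le => e e0.
have [M hM] := cu e e0; exists M => // i /= Mi.
rewrite ger0_norm; last exact: (si_ge0 L2s (siB L2s (Lu i) Lp)).
by rewrite -lee_fin L2_dotE//; [exact: key hM i Mi|exact: (siB L2s)].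
Qed.

End Riesz_Fischer.

(** * Borel sets and continuous functions *)

Section borel_rV.
Context {R : realType} {n : nat}.
Implicit Types (U D : set 'rV[R]_n) (x y : 'rV[R]_n).

Lemma coord_le_norm x i : `|x ord0 i| <= `|x|.
Proof.
by rewrite [leRHS]mx_normrE; apply: (le_bigmax _ (fun ij => `|x ij.1 ij.2|) (ord0, i)).
Qed.

Lemma rV_box_measurable (A : 'I_n -> set R) : (forall i, measurable (A i)) ->
  measurable [set x : 'rV[R]_n | forall i, A i (x ord0 i)].
Proof.
move=> mA; rewrite (_ : mkset _ =
    \bigcap_i ((fun x : 'rV_n => x ord0 i) @^-1` A i)).
  apply: fin_bigcap_measurable => // i _.
  by rewrite -[X in measurable X]setTI; exact: measurable_coord.
by apply/seteqP; split => x /= Ax i//; [move=> _|]; exact: Ax.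
Qed.

(** The sigma-algebra is generated by the coordinates, so [U] has to be written as a countable union
    of boxes, here cubes with rational centers. *)
Lemma rV_open_measurable U : open U -> measurable U.
Proof.
move=> oU.
have [r r_gt0 r_small] : exists2 r : nat -> R, (forall k, 0 < r k) &
    forall e, 0 < e -> exists k, r k < e.
  exists (fun k => k.+1%:R^-1) => [k|e e0]; first by rewrite invr_gt0.
  exact: filter_ex (near_infty_natSinv_lt (PosNum e0)).
pose box (q : 'rV[rat]_n) (k : nat) : set 'rV[R]_n := [set x | forall i,
  `]ratr (q ord0 i) - r k, ratr (q ord0 i) + r k[%classic (x ord0 i)].
(* Cubes that leave [U] are emptied, so that the union runs over a whole countable type. *)
pose B (p : 'rV[rat]_n * nat) :=
  if `[< box p.1 p.2 `<=` U >] then box p.1 p.2 else set0.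
have -> : U = \bigcup_p B p.
  apply/seteqP; split => [x Ux|x [p _]]; last first.
    by rewrite /B; case: ifPn => // /asboolP; exact.
  have /nbhs_ballP[e /= e0 xeU] : nbhs x U by exact: open_nbhs_nbhs.
  (* Both [x] and any point of the cube are within [r k] of its center, hence within [2 r k < e] of
     each other. *)
  have [k ke] : exists k, r k < e / 2 by apply: r_small; rewrite divr_gt0.
  have k0 := r_gt0 k.
  have /choice[q qP] i : exists q : rat,
      ratr q \in `]x ord0 i - r k, x ord0 i + r k[.
    by apply: rat_in_itvoo; lra.
  exists (\row_i q i, k) => //; rewrite /B ifT.
    move=> i /=; rewrite mxE in_itv/=.
    by have := qP i; rewrite in_itv/= => /andP[? ?]; apply/andP; split; lra.
  apply/asboolP => y By; apply: xeU; split => // a i; rewrite (ord1 a){a}.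
  have := qP i; have := By i.
  rewrite /= mxE !in_itv/= /ball/= => /andP[? ?] /andP[? ?].
  by rewrite ltr_norml; apply/andP; split; lra.
apply: (@countable_bigcupT_measurable _ _ _ B) => [|p]; first exact: countableP.
rewrite /B; case: ifPn => // _.
apply: (@rV_box_measurable (fun i =>
  `]ratr (p.1 ord0 i) - r p.2, ratr (p.1 ord0 i) + r p.2[%classic)) => i.
exact: measurable_itv.
Qed.

Lemma rV_within_continuous_measurable_fun D (f : 'rV[R]_n -> R) :
  measurable D -> {within D, continuous f} -> measurable_fun D f.
Proof.
move=> mD /continuousP cf; apply: (measurability _ (RGenOpens.measurableE R)).
move=> _ [_ [a [b ->] <-]].
have /open_subspaceP[V oV VD] : open (from_subspace D f @^-1` `]a, b[).
  by apply: cf; exact: interval_open.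
rewrite setIC -VD; apply: measurableI => //; exact: rV_open_measurable.
Qed.

Lemma rV_open_continuous_measurable_fun D (f : 'rV[R]_n -> R) :
  open D -> (forall x, D x -> {for x, continuous f}) -> measurable_fun D f.
Proof.
move=> oD cf; apply: rV_within_continuous_measurable_fun.
  exact: rV_open_measurable.
by apply: continuous_in_subspaceT => x /set_mem; exact: cf.
Qed.

Definition cube (M : R) : set 'rV[R]_n :=
  [set x | forall i, `[- M, M]%classic (x ord0 i)].

Lemma bounded_sub_cube D : bounded_set D -> exists M, D `<=` cube M.
Proof.
move=> [M [_ hM]]; exists (M + 1) => x Dx i; rewrite /= in_itv/= -ler_norml.
by apply: (le_trans (coord_le_norm x i)); apply: hM Dx; rewrite ltrDl.
Qed.

Lemma bounded_measure_lty D : bounded_set D -> measurable D ->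
  (lebesgue_rV R n D < +oo)%E.
Proof.
move=> /bounded_sub_cube[M DM] mD.
have mi i : measurable ((fun _ : 'I_n => `[- M, M]%classic : set R) i).
  exact: measurable_itv.
apply: (@le_lt_trans _ _ (lebesgue_rV R n (cube M))).
  by apply: le_measure => //; rewrite inE//; exact: (rV_box_measurable mi).
rewrite /cube (lebesgue_rV_box mi).
set P := (X in (X < _)%E); suff : (0 <= P < +oo)%E by case/andP.
rewrite {}/P; apply: (big_ind (fun a => (0 <= a < +oo)%E)) => [|a b|i _].
- by rewrite lee01 ltry.
- move=> /andP[a0 aoo] /andP[b0 boo]; rewrite mule_ge0//=.
  by apply: lte_mul_pinfty => //; rewrite ge0_fin_numE.
- rewrite measure_ge0 lebesgue_measure_itv/=.
  by case: ifP => // _; rewrite -EFinB ltry.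
Qed.

Lemma continuous_bounded_on D (f : 'rV[R]_n -> R) : bounded_set D ->
  continuous f -> exists C, forall x, D x -> `|f x| <= C.
Proof.
move=> /bounded_sub_cube[M DM] cf.
have cK : compact (cube M).
  apply: (@rV_compact _ _ (fun=> `[- M, M]%classic)) => i.
  exact: segment_compact.
have /compact_bounded[C [_ hC]] : compact (f @` cube M).
  by apply: continuous_compact => //; exact: continuous_subspaceT.
exists (C + 1) => x Dx; apply: hC; first by rewrite ltrDl.
by exists x => //; exact: DM.
Qed.

End borel_rV.

(** * Test functions *)

Section test_functions.
Context {R : realType} {n : nat}.
Implicit Types (D : set 'rV[R]_n) (f g : 'rV[R]_n -> R) (x : 'rV[R]_n) (i j : 'I_n).
Local Notation e_ i := (delta_mx ord0 i : 'rV[R]_n).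

Lemma coord_derive_cvg i j x :
  (fun h : R => h^-1 *:
      (((fun y : 'rV[R]_n => y ord0 j) \o shift x) (h *: e_ i) - x ord0 j))
    @ 0^' --> ((i == j)%:R : R).
Proof.
apply: cvg_near_cst; near=> h.
have h0 : h != 0 by near: h; exact: nbhs_dnbhs_neq.
by rewrite /= !mxE addrK eqxx/= eq_sym /GRing.scale/= mulKf.
Unshelve. all: by end_near. Qed.

Lemma derivable_coord i j x : derivable (fun y : 'rV[R]_n => y ord0 j) x (e_ i).
Proof. by apply/cvg_ex; exists (i == j)%:R; exact: coord_derive_cvg. Qed.

Lemma partial_coord i j x : partial i (fun y => y ord0 j) x = (i == j)%:R.
Proof. exact/cvg_lim/coord_derive_cvg. Qed.

Lemma partial_lin i (c : R) f g x : derivable f x (e_ i) -> derivable g x (e_ i) ->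
  partial i (fun y => c * f y + g y) x = c * partial i f x + partial i g x.
Proof.
move=> df dg; rewrite /partial.
rewrite (_ : (fun y => c * f y + g y) = (c *: (f : _ -> R^o) + g))//.
by rewrite (deriveD (derivableZ df) dg) (deriveZ c df).
Qed.

Lemma partial_coordM i j f x : derivable f x (e_ i) ->
  partial i (fun y => y ord0 j * f y) x =
    (i == j)%:R * f x + x ord0 j * partial i f x.
Proof.
move=> df; rewrite {1}/partial.
rewrite (_ : (fun y : 'rV[R]_n => y ord0 j * f y) =
  (fun y : 'rV[R]_n => y ord0 j) * f)//.
rewrite (deriveM (@derivable_coord i j x) df).
rewrite -/(partial i f x) -/(partial i (fun y : 'rV[R]_n => y ord0 j) x).
by rewrite partial_coord /GRing.scale/=; ring.
Qed.

Lemma Ck_lin k (c : R) f g : Ck_on k setT f -> Ck_on k setT g ->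
  Ck_on k setT (fun x => c * f x + g x).
Proof.
elim: k f g => [|k IH] f g [cf Hf] [cg Hg].
  split => // x _; apply: continuousD; last exact: (cg x I).
  by apply: (@continuousM _ _ (cst c) f x); [exact: cst_continuous|exact: (cf x I)].
split => [x _|i].
  apply: continuousD; last exact: (cg x I).
  by apply: (@continuousM _ _ (cst c) f x); [exact: cst_continuous|exact: (cf x I)].
have [df Cf] := Hf i; have [dg Cg] := Hg i.
split => [x _|].
  exact: (derivableD (@derivableZ _ _ _ _ c _ _ (df x I)) (dg x I)).
rewrite (_ : partial i _ = fun x => c * partial i f x + partial i g x).
  exact: IH.
by apply/funext => x; exact: partial_lin (df x I) (dg x I).
Qed.

Lemma CkS k f : Ck_on k.+1 setT f -> Ck_on k setT f.
Proof.
elim: k f => [|k IH] f [cf Hf]; split => // i.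
by have [df Cf] := Hf i; split => //; exact: IH.
Qed.

(** Products with a coordinate are the ones that Poincare's inequality calls for. In the induction
    [partial i] leaves one term with [f] itself, handled by [CkS], and one of the same shape. *)
Lemma Ck_coordM k j f : Ck_on k setT f -> Ck_on k setT (fun x => x ord0 j * f x).
Proof.
have cM f' : continuous f' -> continuous (fun x => x ord0 j * f' x).
  by move=> cf x; apply: continuousM; [exact: coord_continuous|exact: cf].
elim: k f => [|k IH] f Cf; have [cf Hf] := Cf.
  by split => // x _; apply: cM => y; exact: cf.
split => [x _|i]; first by apply: cM => y; exact: cf.
have [df Cfi] := Hf i.
split => [x _|].
  exact: (derivableM (@derivable_coord i j x) (df x I)).
rewrite (_ : partial i _ = fun x => (i == j)%:R * f x + x ord0 j * partial i f x).
  by apply: Ck_lin; [exact: CkS|exact: IH].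
by apply/funext => x; exact: partial_coordM (df x I).
Qed.

Lemma smooth_derivable f : smooth_on setT f -> forall x i, derivable f x (e_ i).
Proof. by move=> sf x i; have [_ /(_ i)[+ _]] := sf 1%N; exact. Qed.

Lemma smooth_continuous f : smooth_on setT f -> continuous f.
Proof. by move=> sf x; exact: (sf 0%N).1. Qed.

Lemma smooth_partial_continuous f i : smooth_on setT f -> continuous (partial i f).
Proof. by move=> sf x; have [_ /(_ i)[_ [+ _]]] := sf 1%N; exact. Qed.

Lemma test_fun0 D : test_fun D (cst 0).
Proof.
have s0 : [set x : 'rV[R]_n | cst 0 x != 0 :> R] = set0.
  by apply/seteqP; split => x //=; rewrite eqxx.
split; rewrite ?s0 ?closure0//; last exact: compact0.
elim => [|k IH]; first by split => // x _; exact: cst_continuous.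
split => [x _|i]; first exact: cst_continuous.
split => [x _|]; first exact: derivable_cst.
by rewrite (_ : partial i _ = cst 0)//; apply/funext => x; exact: derive_cst.
Qed.

Lemma test_fun_lin D (c : R) f g : test_fun D f -> test_fun D g ->
  test_fun D (fun x => c * f x + g x).
Proof.
move=> [sf kf Df] [sg kg Dg].
have sub : closure [set x | c * f x + g x != 0] `<=`
    closure [set x | f x != 0] `|` closure [set x | g x != 0].
  rewrite -closureU; apply: closureS => x /=.
  have [->|fx] := eqVneq (f x) 0; last by left.
  by rewrite mulr0 add0r; right.
split.
- by move=> k; apply: Ck_lin; [exact: sf|exact: sg].
- by apply: subclosed_compact sub; [exact: closed_closure|exact: compactU].
- by apply: (subset_trans sub) => x []; [exact: Df|exact: Dg].
Qed.

Lemma test_fun_coordM D j f : test_fun D f -> test_fun D (fun x => x ord0 j * f x).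
Proof.
move=> [sf kf Df].
have sub : closure [set x : 'rV[R]_n | x ord0 j * f x != 0] `<=`
    closure [set x | f x != 0].
  by apply: closureS => x /=; rewrite mulf_eq0 negb_or => /andP[].
split.
- by move=> k; apply: Ck_coordM; exact: sf.
- by apply: subclosed_compact sub => //; exact: closed_closure.
- exact: (subset_trans sub).
Qed.

End test_functions.

(** * The Sobolev spaces *)

Section L2_pairs.
Context {R : realType} {n : nat}.
Local Notation mu := (lebesgue_rV R n).
Variable D : set 'rV[R]_n.
Hypothesis mD : measurable D.
Implicit Types u v w : sobolev R n.
Local Notation L2s := (@L2_semi_inner R n D mD).

Definition component (X : 'rV[R]_n -> 'rV[R]_n) (i : 'I_n) : 'rV[R]_n -> R^o :=
  fun x => X x ord0 i.

(* Dropping the weak gradient condition, one need not integrate by parts to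
   know that [of_test eta] is a member. *)
Definition L2_pair u : Prop := L2 D u.1 /\ forall i, L2 D (component u.2 i).

Definition grad_dot u v : R := \sum_i L2_dot D (component u.2 i) (component v.2 i).

Definition H1_dot u v : R := L2_dot D u.1 v.1 + grad_dot u v.

(** Integrability and value go together, since splitting off a term of the integral requires the
    rest to be integrable. *)
Lemma Rintegral_sum (I : Type) (s : seq I) (f : I -> 'rV[R]_n -> R) :
  (forall i, mu.-integrable D (EFin \o f i)) ->
  mu.-integrable D (EFin \o (fun x => \sum_(i <- s) f i x)) /\
  \int[mu]_(x in D) (\sum_(i <- s) f i x) = \sum_(i <- s) \int[mu]_(x in D) f i x.
Proof.
move=> If; elim: s => [|i s [Is IH]].
  rewrite big_nil.
  under [X in _.-integrable _ (_ \o X)]eq_fun do rewrite big_nil.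
  split; first exact: integrable0.
  by rewrite /Rintegral integral0_eq// => x _; rewrite big_nil.
have e : (fun x => \sum_(j <- i :: s) f j x) =
    (fun x => f i x + \sum_(j <- s) f j x).
  by apply/funext => x; rewrite big_cons.
rewrite e; split; first exact: (integrableD mD (If i) Is).
by rewrite RintegralD// IH big_cons.
Qed.

Lemma L2_pair_dotp u v : L2_pair u -> L2_pair v ->
  mu.-integrable D (EFin \o (fun x => dotp (u.2 x) (v.2 x))) /\
  \int[mu]_(x in D) dotp (u.2 x) (v.2 x) = grad_dot u v.
Proof.
move=> [_ Lu] [_ Lv]; apply: Rintegral_sum => i.
exact: (L2_mul_integrable mD (Lu i) (Lv i)).
Qed.

Lemma H1_normE u : L2_pair u -> H1_norm D u = Num.sqrt (H1_dot u u).
Proof.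
move=> Lu; congr Num.sqrt; have [I2 E2] := L2_pair_dotp Lu Lu.
under eq_Rintegral do rewrite expr2.
by rewrite RintegralD ?E2//; exact: (L2_mul_integrable mD Lu.1 Lu.1).
Qed.

Lemma L2_pair_lin c u v : L2_pair u -> L2_pair v -> L2_pair (c *: u + v).
Proof.
move=> [u1 u2] [v1 v2]; split; first exact: (siP L2s).
move=> i; rewrite (_ : component _ i = c *: component u.2 i + component v.2 i).
  exact: (siP L2s).
by apply/funext => x; rewrite /component/= !mxE.
Qed.

Lemma H1_semi_inner : semi_inner L2_pair H1_dot.
Proof.
split.
- split; first exact: L2_0.
  move=> i; rewrite (_ : component _ i = cst 0); first exact: L2_0.
  by apply/funext => x; rewrite /component/= mxE.
- exact: L2_pair_lin.
- move=> c u v w [u1 u2] [v1 v2] [w1 w2]; rewrite /H1_dot /grad_dot.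
  rewrite (siPl L2s c u1 v1 w1) mulrDr mulr_sumr -!addrA; congr (_ + _).
  rewrite addrCA; congr (_ + _); rewrite -big_split/=; apply: eq_bigr => i _.
  rewrite -(siPl L2s c (u2 i) (v2 i) (w2 i)); congr L2_dot.
  by apply/funext => x; rewrite /component/= !mxE.
- move=> u v [u1 u2] [v1 v2]; rewrite /H1_dot (siC L2s u1 v1); congr (_ + _).
  by apply: eq_bigr => i _; rewrite (siC L2s).
- move=> u [u1 u2]; rewrite addr_ge0 ?(si_ge0 L2s)//.
  by apply: sumr_ge0 => i _; exact: (si_ge0 L2s).
Qed.

Lemma L2_dot_le_H1 u : L2_pair u -> L2_dot D u.1 u.1 <= H1_dot u u.
Proof.
move=> [_ u2]; rewrite lerDl; apply: sumr_ge0 => i _; exact: (si_ge0 L2s).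
Qed.

Lemma coord_dot_le_grad u i : L2_pair u ->
  L2_dot D (component u.2 i) (component u.2 i) <= grad_dot u u.
Proof.
move=> [_ u2]; rewrite /grad_dot (bigD1 i)//= lerDl.
by apply: sumr_ge0 => j _; exact: (si_ge0 L2s).
Qed.

Lemma grad_dot_le_H1 u : L2_pair u -> grad_dot u u <= H1_dot u u.
Proof. by move=> [u1 _]; rewrite lerDr; exact: (si_ge0 L2s). Qed.

Lemma componentB (X Y : 'rV[R]_n -> 'rV[R]_n) i :
  component (X - Y) i = component X i - component Y i.
Proof. by apply/funext => x; rewrite /component/= !mxE. Qed.

Lemma H1_cvg_fst (u : nat -> sobolev R n) p :
  (forall k, L2_pair (u k)) -> L2_pair p ->
  H1_dot (u k - p) (u k - p) @[k --> \oo] --> (0 : R) ->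
  L2_dot D ((u k).1 - p.1) ((u k).1 - p.1) @[k --> \oo] --> (0 : R).
Proof.
move=> Lu Lp; apply: squeeze_cvgr (cvg_cst _); apply: nearW => k.
have Lup := siB H1_semi_inner (Lu k) Lp.
by rewrite (L2_dot_le_H1 Lup) (si_ge0 L2s Lup.1).
Qed.

Lemma H1_cvg_snd (u : nat -> sobolev R n) p i :
  (forall k, L2_pair (u k)) -> L2_pair p ->
  H1_dot (u k - p) (u k - p) @[k --> \oo] --> (0 : R) ->
  L2_dot D (component (u k).2 i - component p.2 i)
           (component (u k).2 i - component p.2 i)
    @[k --> \oo] --> (0 : R).
Proof.
move=> Lu Lp; apply: squeeze_cvgr (cvg_cst _); apply: nearW => k.
have Lup := siB H1_semi_inner (Lu k) Lp.
have := coord_dot_le_grad i Lup; rewrite componentB => h.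
rewrite (le_trans h (grad_dot_le_H1 Lup)) andbT.
by have := si_ge0 L2s (Lup.2 i); rewrite componentB.
Qed.

Hypothesis Doo : (mu D < +oo)%E.

(** The function and each component of the field converge separately. That the limit field is again
    the weak gradient is left to [weak_grad_closed]. *)
Lemma H1_complete : complete_form L2_pair H1_dot.
Proof.
move=> u Lu cu.
have L2c := L2_complete mD Doo.
have [k|e e0|p1 Lp1 cp1] := L2c (fun k => (u k).1).
- exact: (Lu k).1.
- have [N NP] := cu e e0; exists N => i j Ni Nj.
  apply: le_lt_trans (NP i j Ni Nj).
  exact: (L2_dot_le_H1 (siB H1_semi_inner (Lu i) (Lu j))).
have /choice[p2 p2P] i : exists q : 'rV[R]_n -> R^o, L2 D q /\
   L2_dot D (component (u k).2 i - q) (component (u k).2 i - q)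
     @[k --> \oo] --> (0 : R).
  have [k|e e0|q Lq cq] := L2c (fun k => component (u k).2 i); last by exists q.
  - exact: (Lu k).2.
  - have [N NP] := cu e e0; exists N => j k Nj Nk.
    apply: le_lt_trans (NP j k Nj Nk).
    have Ljk := siB H1_semi_inner (Lu j) (Lu k).
    apply: le_trans (grad_dot_le_H1 Ljk).
    by have := coord_dot_le_grad i Ljk; rewrite componentB.
pose p : sobolev R n := (p1, fun x => \row_i p2 i x).
have pE i : component p.2 i = p2 i by apply/funext => x; rewrite /component/= mxE.
have Lp : L2_pair p by split => // i; rewrite pE; exact: (p2P i).1.
exists p => //.
rewrite -[X in _ --> X]addr0; apply: cvgD => //.
rewrite [X in _ --> X](_ : 0 = \sum_(i < n) (0 : R)); last by rewrite big1.
apply: cvg_big => [|i _]; first exact: add_continuous.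
by under eq_fun do rewrite componentB pE; exact: (p2P i).2.
Qed.

End L2_pairs.

Section sobolev_spaces.
Context {R : realType} {n : nat}.
Local Notation mu := (lebesgue_rV R n).
Variable D : set 'rV[R]_n.
Hypothesis mD : measurable D.
Hypothesis Doo : (mu D < +oo)%E.
Hypothesis bD : bounded_set D.
Implicit Types u v w p : sobolev R n.
Local Notation L2s := (@L2_semi_inner R n D mD).
Local Notation H1s := (@H1_semi_inner R n D mD).

Lemma continuous_L2 f : continuous f -> L2 D f.
Proof.
move=> cf; have mf : measurable_fun D f.
  apply: measurable_funTS.
  exact: rV_open_continuous_measurable_fun openT (fun x _ => cf x).
apply: L2_intro => //; apply: measurable_bounded_integrable => //.
  exact: measurable_funM.
have [C hC] := continuous_bounded_on bD cf.
exists (C ^+ 2); split; first exact: num_real.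
move=> M CM x Dx; rewrite /= normrM -expr2; apply/ltW/(le_lt_trans _ CM).
by rewrite ler_sqr ?nnegrE ?(le_trans _ (hC x Dx))// hC.
Qed.

Lemma coordM_L2 j f : L2 D f -> L2 D (fun x => x ord0 j * f x).
Proof.
move=> Lf; have cj : continuous (fun x : 'rV[R]_n => x ord0 j).
  exact: coord_continuous.
have [C hC] := continuous_bounded_on bD cj.
have mj : measurable_fun D (fun x : 'rV[R]_n => x ord0 j).
  exact: measurable_funTS (measurable_coord j).
apply: L2_intro => //; first by apply: measurable_funM => //; exact: Lf.1.
have := integrableZl mD (C ^+ 2) (L2_mul_integrable mD Lf Lf).
apply: le_integrable => //.
  apply/measurable_EFinP.
  by apply: measurable_funM; apply: measurable_funM => //; exact: Lf.1.
move=> x Dx; rewrite [leLHS]/= [leRHS]/= lee_fin !normrM.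
rewrite mulrACA ler_wpM2r ?mulr_ge0//.
have h : `|x ord0 j| <= `|C| by apply: (le_trans (hC x Dx)); exact: ler_norm.
exact: ler_pM.
Qed.

Lemma coordM_dot_le j : exists2 C, 0 <= C &
  forall f, L2 D f ->
    L2_dot D (fun x => x ord0 j * f x) (fun x => x ord0 j * f x) <=
      C * L2_dot D f f.
Proof.
have cj : continuous (fun x : 'rV[R]_n => x ord0 j) by exact: coord_continuous.
have [C hC] := continuous_bounded_on bD cj.
exists (C ^+ 2); first exact: sqr_ge0.
move=> f Lf; rewrite /L2_dot -RintegralZl//;
  last exact: (L2_mul_integrable mD Lf Lf).
apply: le_Rintegral => //.
- exact: (L2_mul_integrable mD (coordM_L2 j Lf) (coordM_L2 j Lf)).
- exact: (integrableZl mD (C ^+ 2) (L2_mul_integrable mD Lf Lf)).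
- move=> x Dx; rewrite mulrACA ler_wpM2r -?expr2 ?sqr_ge0//.
  rewrite -(@real_normK _ (x ord0 j)) ?num_real// ler_sqr ?nnegrE ?hC//.
  exact: le_trans (hC x Dx).
Qed.

Lemma test_L2_pair eta : test_fun D eta -> L2_pair D (of_test eta).
Proof.
move=> [seta _ _]; split; first exact/continuous_L2/smooth_continuous.
move=> i; rewrite (_ : component _ i = partial i eta).
  exact/continuous_L2/smooth_partial_continuous.
by apply/funext => x; rewrite /component/= mxE.
Qed.

Lemma H1_L2_pair u : H1 D u -> L2_pair D u.
Proof. by move=> [u1 u2 _]; split. Qed.

Lemma H10_L2_pair u : H10 D u -> L2_pair D u.
Proof. by move=> [/H1_L2_pair]. Qed.

Lemma of_test_lin (c : R) (f g : 'rV[R]_n -> R) :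
  smooth_on setT f -> smooth_on setT g ->
  of_test (fun x => c * f x + g x) = c *: of_test f + of_test g.
Proof.
move=> sf sg; congr pair; apply/funext => x; apply/rowP => i.
by rewrite !mxE partial_lin//; exact: smooth_derivable.
Qed.

Lemma H1_lin c u v : H1 D u -> H1 D v -> H1 D (c *: u + v).
Proof.
move=> Hu Hv; have [u1 u2] := H1_L2_pair Hu; have [v1 v2] := H1_L2_pair Hv.
have [w1 w2] := L2_pair_lin mD c (H1_L2_pair Hu) (H1_L2_pair Hv).
split => // i eta teta; have [Leta Lpeta] := test_L2_pair teta.
have [seta _ _] := teta.
have Lpi : L2 D (partial i eta) by exact/continuous_L2/smooth_partial_continuous.
have [_ _ /(_ i _ teta) wu] := Hu; have [_ _ /(_ i _ teta) wv] := Hv.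
have := siPl L2s c u1 v1 Lpi; rewrite /L2_dot wu wv => ->.
have := siPl L2s c (u2 i) (v2 i) Leta; rewrite /L2_dot/= => e.
rewrite mulrN -opprD -e; congr (- _).
by apply: eq_Rintegral => x _; rewrite /component/= !mxE.
Qed.

(** For a fixed test function both sides of the defining identity are products with a fixed square
    integrable function, hence pass to the limit. *)
Lemma weak_grad_closed (u : nat -> sobolev R n) p :
  (forall k, H1 D (u k)) -> L2_pair D p ->
  H1_dot D (u k - p) (u k - p) @[k --> \oo] --> (0 : R) -> H1 D p.
Proof.
move=> Hu Lp up; have [p1 p2] := Lp.
have Lu k := H1_L2_pair (Hu k).
split => // i eta teta; have [Leta _] := test_L2_pair teta.
have [seta _ _] := teta.
have Lpi : L2 D (partial i eta) by exact/continuous_L2/smooth_partial_continuous.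
have c1 := si_cvgl L2s (fun k => (Lu k).1) p1 Lpi (H1_cvg_fst mD Lu Lp up).
have c2 := si_cvgl L2s (fun k => (Lu k).2 i) (p2 i) Leta (H1_cvg_snd mD i Lu Lp up).
apply: (cvg_unique _ c1) => //.
rewrite (_ : (fun k => _) = (fun k => - L2_dot D (component (u k).2 i) eta)).
  exact: cvgN.
by apply/funext => k; have [_ _ /(_ i _ teta)] := Hu k.
Qed.

Lemma H1_dot_opp u v : L2_pair D u -> L2_pair D v ->
  H1_dot D (u - v) (u - v) = H1_dot D (v - u) (v - u).
Proof.
move=> Lu Lv; have Lvu := siB H1s Lv Lu; have LNvu := siZ H1s (-1) Lvu.
rewrite -(opprB v u) -scaleN1r (siZl H1s (-1) Lvu LNvu) (siZr H1s (-1) Lvu Lvu).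
by rewrite mulrA mulN1r opprK mul1r.
Qed.

(** The closure of a closure adds nothing: half of [e] goes to [v], half to a test function near
    [v]. *)
Lemma H10P u : H1 D u -> (forall e, 0 < e -> exists2 v, H10 D v &
    H1_dot D (u - v) (u - v) < e) -> H10 D u.
Proof.
move=> Hu uv; split => // e e0.
have e20 : 0 < e / 2 by rewrite divr_gt0.
have [v Hv uve] := uv ((e / 2) ^+ 2) (exprn_gt0 _ e20).
have [eta teta veta] := Hv.2 _ e20.
exists eta => //.
have Lu := H1_L2_pair Hu; have Lv := H10_L2_pair Hv; have Le := test_L2_pair teta.
have Luv := siB H1s Lu Lv; have Lve := siB H1s Lv Le.
rewrite (H1_normE mD (siB H1s Lu Le)) -(subrKA v u (- of_test eta)).
apply: (le_lt_trans (si_normD H1s Luv Lve)).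
rewrite (splitr e) -(H1_normE mD Lve); apply: ltr_leD; last exact: ltW.
by rewrite -(@gtr0_norm _ (e / 2))// -sqrtr_sqr ltr_sqrt// exprn_gt0.
Qed.

Lemma H10_closed (u : nat -> sobolev R n) p :
  (forall k, H10 D (u k)) -> L2_pair D p ->
  H1_dot D (u k - p) (u k - p) @[k --> \oo] --> (0 : R) -> H10 D p.
Proof.
move=> Hu Lp up; apply: H10P.
  by apply: weak_grad_closed up => // k; exact: (Hu k).1.
move=> e e0.
have [k ke] : exists k, H1_dot D (u k - p) (u k - p) < e.
  exact: filter_ex (cvgr_lt 0 up _ e0).
exists (u k) => //.
have Luk := H10_L2_pair (Hu k).
by rewrite (H1_dot_opp Lp Luk).
Qed.

Lemma H10_test_seq u : H10 D u -> exists2 eta : nat -> 'rV[R]_n -> R,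
  forall k, test_fun D (eta k) &
  H1_dot D (of_test (eta k) - u) (of_test (eta k) - u) @[k --> \oo] --> (0 : R).
Proof.
move=> Hu; have Lu := H10_L2_pair Hu.
have /choice[eta etaP] k : exists eta, test_fun D eta /\
    H1_norm D (u - of_test eta) < k.+1%:R^-1.
  have k0 : 0 < k.+1%:R^-1 :> R by rewrite invr_gt0.
  by have [eta ? ?] := Hu.2 _ k0; exists eta.
exists eta => [k|]; first exact: (etaP k).1.
have c0 : k.+1%:R^-1 ^+ 2 @[k --> \oo] --> (0 : R).
  rewrite (_ : (fun k => _) = (@harmonic R) \* (@harmonic R)); last first.
    by apply/funext => k; rewrite expr2.
  have := cvgM (@cvg_harmonic R) (@cvg_harmonic R); by rewrite mulr0; exact.
apply: (squeeze_cvgr _ (cvg_cst _) c0); apply: nearW => k.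
have Le := test_L2_pair (etaP k).1.
have Lue := siB H1s Lu Le.
rewrite -(H1_dot_opp Lu Le) (si_ge0 H1s Lue)/=.
rewrite -(sqr_sqrtr (si_ge0 H1s Lue)) -(H1_normE mD Lue).
by rewrite ler_sqr ?nnegrE ?sqrtr_ge0 ?invr_ge0//; exact: ltW (etaP k).2.
Qed.

Lemma H10_linear : [/\ H10 D 0 &
  forall c u v, H10 D u -> H10 D v -> H10 D (c *: u + v)].
Proof.
have H0 : H1 D 0.
  split; first exact: (si0 H1s).1.
    exact: (si0 H1s).2.
  move=> i eta teta.
  rewrite /Rintegral !integral0_eq//= ?oppr0// => x _;
    rewrite ?mxE; congr EFin; exact: mul0r.
split.
  split => // e e0; exists (cst 0); first exact: test_fun0.
  rewrite (_ : of_test _ = 0); last first.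
    congr pair; apply/funext => x; apply/rowP => i; rewrite !mxE; exact: derive_cst.
  rewrite subr0 (H1_normE mD (si0 H1s)).
  by rewrite (si0l H1s (si0 H1s)) sqrtr0.
move=> c u v Hu Hv; split; first by apply: H1_lin; [exact: Hu.1|exact: Hv.1].
move=> e e0.
(* The factor [c] magnifies the error on [u]; the added 1 covers [c = 0]. *)
have d0 : 0 < e / 2 / (`|c| + 1) by rewrite !divr_gt0// ltr_wpDl.
have [f tf uf] := Hu.2 _ d0.
have e20 : 0 < e / 2 by rewrite divr_gt0.
have [g tg vg] := Hv.2 _ e20.
exists (fun x => c * f x + g x); first exact: test_fun_lin.
have [sf _ _] := tf; have [sg _ _] := tg.
have Luf := siB H1s (H10_L2_pair Hu) (test_L2_pair tf).
have Lvg := siB H1s (H10_L2_pair Hv) (test_L2_pair tg).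
have Lc := siZ H1s c Luf.
rewrite of_test_lin// (_ : _ - _ = c *: (u - of_test f) + (v - of_test g)); last first.
  by rewrite scalerBr addrACA opprD.
rewrite (H1_normE mD (siD H1s Lc Lvg)).
apply: (le_lt_trans (si_normD H1s Lc Lvg)).
rewrite (splitr e); apply: ler_ltD; last by rewrite -(H1_normE mD Lvg).
rewrite (siZl H1s c Luf Lc) (siZr H1s c Luf Luf) mulrA -expr2 sqrtrM ?sqr_ge0//.
rewrite sqrtr_sqr -(H1_normE mD Luf).
move/ltW : uf; rewrite ler_pdivlMr ?ltr_wpDl// mulrC => /(le_trans _); apply.
by rewrite ler_wpM2r ?sqrtr_ge0// lerDl.
Qed.

(* Since [x_j eta] is a test function whenever [eta] is, the definition of the
   weak gradient, tested with [x_j eta] and [eta -> u], gives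
   [|u|^2 = - 2 (u, x_j d_j u)]. *)
Lemma poincare (j : 'I_n) : exists2 C, 0 <= C &
  forall u, H10 D u ->
    L2_dot D u.1 u.1 <= C * L2_dot D (component u.2 j) (component u.2 j).
Proof.
have [C C0 CP] := coordM_dot_le j.
exists (4 * C) => [|u Hu]; first exact: mulr_ge0.
have [u1 u2] := H10_L2_pair Hu.
have [eta teta ceta] := H10_test_seq Hu.
have Le k := test_L2_pair (teta k).
have Lu := H10_L2_pair Hu.
pose w := component u.2 j.
have Lw : L2 D w := u2 j.
pose xu : 'rV[R]_n -> R^o := fun x => x ord0 j * u.1 x.
pose xw : 'rV[R]_n -> R^o := fun x => x ord0 j * w x.
have Lxu : L2 D xu := coordM_L2 j u1.
have Lxw : L2 D xw := coordM_L2 j Lw.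
have c1 r (Lr : L2 D r) := si_cvgl L2s (fun k => (Le k).1) u1 Lr
  (H1_cvg_fst mD Le Lu ceta).
have c2 r (Lr : L2 D r) := si_cvgl L2s (fun k => (Le k).2 j) (u2 j) Lr
  (H1_cvg_snd mD j Le Lu ceta).
have e0 k : L2_dot D (of_test (eta k)).1 u.1
    + L2_dot D (component (of_test (eta k)).2 j) xu
    + L2_dot D (of_test (eta k)).1 xw = 0.
  have [_ _ /(_ j _ (test_fun_coordM j (teta k)))] := Hu.1.
  have [sk _ _] := teta k.
  have -> : \int[mu]_(x in D)
       (u.1 x * partial j (fun x0 : 'rV_n => x0 ord0 j * eta k x0) x) =
      L2_dot D (of_test (eta k)).1 u.1
      + L2_dot D (component (of_test (eta k)).2 j) xu.
    rewrite /L2_dot -RintegralD//; last 2 first.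
    - exact: (L2_mul_integrable mD (Le k).1 u1).
    - exact: (L2_mul_integrable mD ((Le k).2 j) Lxu).
    apply: eq_Rintegral => x _.
    rewrite (partial_coordM _ (@smooth_derivable _ _ _ sk x j)) eqxx
      /component /xu/= mxE.
    by rewrite mul1r; ring.
  move=> ->; apply/eqP; rewrite addrC subr_eq0; apply/eqP/eq_Rintegral => x _.
  by rewrite /xw /w /component/=; ring.
have : L2_dot D u.1 u.1 + L2_dot D w xu + L2_dot D u.1 xw = 0.
  have cc : (fun k => L2_dot D (of_test (eta k)).1 u.1 +
        L2_dot D (component (of_test (eta k)).2 j) xu +
        L2_dot D (of_test (eta k)).1 xw) k @[k --> \oo] -->
      L2_dot D u.1 u.1 + L2_dot D w xu + L2_dot D u.1 xw.
    by apply: cvgD; [apply: cvgD; [exact: c1|exact: c2]|exact: c1].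
  apply: (cvg_unique _ cc) => //.
  by apply: cvg_near_cst; apply: nearW => k; exact: e0.
have -> : L2_dot D w xu = L2_dot D u.1 xw.
  by apply: eq_Rintegral => x _; rewrite /xu /xw; ring.
(* Below, [a = - 2 b] gives [a^2 = 4 b^2 <= 4 a d <= a (4 C g)], and [a] cancels when positive. This
   is the origin of [4 * C]. *)
have := si_CS L2s u1 Lxw; have := CP _ Lw.
have := si_ge0 L2s u1; have := si_ge0 L2s Lw.
rewrite -/w -/xw.
set a := L2_dot D u.1 u.1; set b := L2_dot D u.1 xw; set d := L2_dot D xw xw.
set g := L2_dot D w w.
move=> g0 a0 dg ba ab.
have aE : a = - 2 * b by lra.
move: a0; rewrite le_eqVlt => /orP[/eqP <-|a0]; first by rewrite !mulr_ge0.
rewrite -(ler_pM2l a0).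
have : b ^+ 2 <= a * (C * g) by apply: (le_trans ba); rewrite ler_pM2l.
rewrite aE; lra.
Qed.

End sobolev_spaces.

(** * The energy *)

Section energy_form.
Context {R : realType} {n : nat}.
Local Notation mu := (lebesgue_rV R n).
Implicit Types (u v w p : sobolev R n) (A : 'M[R]_n) (x y z : 'rV[R]_n).

Lemma mxdotPl A (c : R) x y z :
  mxdot A (c *: x + y) z = c * mxdot A x z + mxdot A y z.
Proof.
rewrite /mxdot (linearP (@trmx R 1 n)) mulmxDr -scalemxAr.
by rewrite mxE [X in X + _ = _]mxE.
Qed.

Lemma mxdotC A x y : A^T = A -> mxdot A x y = mxdot A y x.
Proof.
move=> AT; rewrite /mxdot -[in LHS](trmxK (y *m A *m x^T)) [in LHS]mxE.
by rewrite !trmx_mul trmxK AT mulmxA.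
Qed.

Lemma mxdot_sum A x y :
  mxdot A x y = \sum_k (\sum_j y ord0 j * A j k) * x ord0 k.
Proof. by rewrite /mxdot mxE; apply: eq_bigr => k _; rewrite mxE [x^T _ _]mxE. Qed.

Variables (Om : set 'rV[R]_n) (phi : 'rV[R]_n -> R) (beta : 'rV[R]_n -> 'M[R]_n).
Variables (m M : R).
Hypotheses (oOm : open Om) (bOm : bounded_set Om).
Hypothesis hphi : interface Om phi.
Hypothesis m0 : 0 < m.
Hypothesis hbeta : piecewise_C1 Om phi beta.
Hypothesis hell : elliptic_coef Om m M beta.

(** The form is nonnegative at [z + y] and [z - y], which bounds the cross term by the two diagonal
    ones. The result is an integrable majorant of the energy density. *)
Lemma mxdot_elliptic_le x y z : Om x ->
  `|mxdot (beta x) y z| <= M * (dotp y y + dotp z z).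
Proof.
move=> Omx; have [bT bb] := hell Omx.
have d0 y' : 0 <= dotp y' y' :> R.
  by apply: sumr_ge0 => i _; rewrite -expr2 sqr_ge0.
have Q0 y' : 0 <= mxdot (beta x) y' y'.
  by have /andP[+ _] := bb y'; apply: le_trans; rewrite mulr_ge0// ltW.
have QD (c : R) : mxdot (beta x) (c *: y + z) (c *: y + z) =
    c ^+ 2 * mxdot (beta x) y y + 2 * c * mxdot (beta x) y z + mxdot (beta x) z z.
  rewrite mxdotPl ![mxdot _ _ (c *: y + z)](mxdotC _ _ bT) !mxdotPl.
  by rewrite (mxdotC z y bT); ring.
have := Q0 (1 *: y + z); have := Q0 ((-1) *: y + z); rewrite !QD.
have /andP[_] := bb y; have /andP[_] := bb z.
have := Q0 y; have := Q0 z; rewrite ler_norml => ? ? ? ? ? ?.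
by apply/andP; split; lra.
Qed.

Let mOm : measurable Om := rV_open_measurable oOm.

(** [Gamma] is the boundary of [Omega_minus], so the coefficient is continuous on the union of the
    two; on [Omega_plus] it agrees with the continuous [gamma]. *)
Lemma measurable_coef i j : measurable_fun Om (fun x => beta x i j).
Proof.
have [sphi _ bG _] := hphi.
have mphi : measurable_fun Om phi.
  by apply: rV_open_continuous_measurable_fun => // x Omx; exact: (sphi 0%N).1.
have mm : measurable (Omega_minus Om phi).
  rewrite /Omega_minus (_ : [set x | phi x < 0] = phi @^-1` `]-oo, 0[%classic).
    by apply: mphi => //; exact: measurable_itv.
  by apply/seteqP; split => x /=; rewrite in_itv.
have mp : measurable (Omega_plus Om phi).
  rewrite /Omega_plus (_ : [set x | 0 < phi x] = phi @^-1` `]0, +oo[%classic).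
    by apply: mphi => //; exact: measurable_itv.
  by apply/seteqP; split => x /=; rewrite in_itv/= andbT.
have mG : measurable (Gamma Om phi).
  rewrite /Gamma (_ : [set x | phi x = 0] = phi @^-1` [set 0]) //.
  by apply: mphi => //; exact: measurable_set1.
have -> : Om = (Omega_minus Om phi `|` Gamma Om phi) `|` Omega_plus Om phi.
  apply/seteqP; split => [x Omx|x [[[]|[]]|[]]//].
  by have [h|h|h] := ltgtP (phi x) 0; [left; left|right|left; right].
have [[_ cm _] [gamma [_ cg _] gE]] := hbeta i j.
apply/measurable_funU => //; first exact: measurableU.
split.
  apply: rV_within_continuous_measurable_fun; first exact: measurableU.
  apply: continuous_subspaceW cm => x [Ox|Gx]; first exact: subset_closure.
  by move: Gx; rewrite -bG => -[].
apply: (eq_measurable_fun gamma) => [x /set_mem Ox|]; first exact: gE.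
apply: rV_within_continuous_measurable_fun => //.
by apply: continuous_subspaceW cg => x Ox; exact: subset_closure.
Qed.

Lemma energy_integrable u v : L2_pair Om u -> L2_pair Om v ->
  mu.-integrable Om (EFin \o (fun x => mxdot (beta x) (u.2 x) (v.2 x))).
Proof.
move=> Lu Lv.
have [Iu _] := L2_pair_dotp mOm Lu Lu; have [Iv _] := L2_pair_dotp mOm Lv Lv.
have := integrableZl mOm M (integrableD mOm Iu Iv).
apply: le_integrable => //.
  apply/measurable_EFinP; under eq_fun do rewrite mxdot_sum.
  apply: measurable_sum => k; apply: measurable_funM; last exact: (Lu.2 k).1.
  apply: measurable_sum => j; apply: measurable_funM; first exact: (Lv.2 j).1.
  exact: measurable_coef.
move=> x Omx; rewrite [leLHS]/= [leRHS]/= lee_fin.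
by apply: (le_trans (mxdot_elliptic_le _ _ Omx)); exact: ler_norm.
Qed.

Lemma energy_ge u : L2_pair Om u -> m * grad_dot Om u u <= energy beta Om u u.
Proof.
move=> Lu; have [Iu <-] := L2_pair_dotp mOm Lu Lu.
rewrite -RintegralZl//; apply: le_Rintegral => //.
- exact: (integrableZl mOm m Iu).
- exact: energy_integrable.
- by move=> x Omx; have [_ /(_ (u.2 x))/andP[]] := hell Omx.
Qed.

Lemma energy_le u : L2_pair Om u -> energy beta Om u u <= M * grad_dot Om u u.
Proof.
move=> Lu; have [Iu <-] := L2_pair_dotp mOm Lu Lu.
rewrite -RintegralZl//; apply: le_Rintegral => //.
- exact: energy_integrable.
- exact: (integrableZl mOm M Iu).
- by move=> x Omx; have [_ /(_ (u.2 x))/andP[]] := hell Omx.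
Qed.

Lemma energyC u v : energy beta Om u v = energy beta Om v u.
Proof.
apply: eq_Rintegral => x /set_mem Omx; apply: mxdotC.
by have [] := hell Omx.
Qed.

Let muOm : (mu Om < +oo)%E := bounded_measure_lty bOm mOm.

Lemma grad_dot_ge0 u : L2_pair Om u -> 0 <= grad_dot Om u u.
Proof.
by move=> [_ Lu]; apply: sumr_ge0 => i _; exact: (si_ge0 (L2_semi_inner mOm)).
Qed.

Lemma energy_semi_inner : semi_inner (H10 Om) (energy beta Om).
Proof.
have [H0 Hlin] := H10_linear mOm muOm bOm.
split => //.
- move=> c u v w /H10_L2_pair Lu /H10_L2_pair Lv /H10_L2_pair Lw.
  have Iu := energy_integrable Lu Lw; have Iv := energy_integrable Lv Lw.
  rewrite /energy -RintegralZl// -RintegralD//; last exact: (integrableZl mOm c Iu).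
  by apply: eq_Rintegral => x _; rewrite -mxdotPl.
- by move=> u v _ _; exact: energyC.
- move=> u /H10_L2_pair Lu; apply: le_trans (energy_ge Lu).
  by rewrite mulr_ge0 ?grad_dot_ge0// ltW.
Qed.

Hypothesis n0 : (0 < n)%N.
Hypothesis mM : m < M.

(** Poincare's inequality in the first coordinate bounds the H^1 product by [C + 1] times the
    gradient part, and ellipticity costs the factor [1 / m]. *)
Lemma H1_dot_le_energy : exists2 C, 0 < C &
  forall u, H10 Om u -> H1_dot Om u u <= C * energy beta Om u u.
Proof.
have [C C0 CP] := poincare mOm muOm bOm (Ordinal n0).
exists ((C + 1) / m) => [|u Hu]; first by rewrite divr_gt0// ltr_wpDl.
have Lu := H10_L2_pair Hu.
rewrite mulrAC ler_pdivlMr//.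
have h1 := CP u Hu; have h2 := coord_dot_le_grad mOm (Ordinal n0) Lu.
have h3 : L2_dot Om u.1 u.1 <= C * grad_dot Om u u.
  by apply: le_trans h1 _; rewrite ler_wpM2l.
apply: (@le_trans _ _ ((C + 1) * (m * grad_dot Om u u))).
  rewrite mulrCA [leLHS]mulrC ler_pM2l// /H1_dot mulrDl mul1r lerD2r//.
by rewrite ler_pM2l ?energy_ge// ltr_wpDl.
Qed.

(** Energy and H^1 norm are equivalent on [H10], which is closed among the pairs for the latter. *)
Lemma energy_complete : complete_form (H10 Om) (energy beta Om).
Proof.
move=> u Hu cu; have Lu k := H10_L2_pair (Hu k).
have H1s := H1_semi_inner mOm; have es := energy_semi_inner.
have [C C0 CP] := H1_dot_le_energy.
have [k|e e0|p Lp up] := H1_complete mOm muOm (u := u); first exact: Lu.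
  have [N NP] := cu (e / C) (divr_gt0 e0 C0).
  exists N => i j Ni Nj; have Hij := siB es (Hu i) (Hu j).
  apply: (le_lt_trans (CP _ Hij)).
  by rewrite mulrC -ltr_pdivlMr//; exact: NP.
have Hp : H10 Om p := H10_closed mOm muOm bOm Hu Lp up.
exists p => //.
have c0 : M * H1_dot Om (u k - p) (u k - p) @[k --> \oo] --> (0 : R).
  by rewrite -[X in _ --> X](mulr0 M); exact: cvgMr.
apply: (squeeze_cvgr _ (cvg_cst _) c0); apply: nearW => k.
have Hup := siB es (Hu k) Hp; have Lup := H10_L2_pair Hup.
rewrite (si_ge0 es Hup)/=; apply: (le_trans (energy_le Lup)).
by rewrite ler_pM2l ?grad_dot_le_H1//; exact: lt_trans m0 mM.
Qed.

End energy_form.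

(** * Solvability of the finite-dimensional problems *)

(** Coercivity makes [v |-> B v] injective from [V] to its dual, and equality of dimensions makes it
    surjective. *)
Lemma coercive_solvable (R : realType) (V : vectType R) (N : V -> R)
    (B : {biscalar V}) (F : {scalar V}) (c : R) :
  is_norm N -> 0 < c -> (forall x, c * N x ^+ 2 <= B x x) ->
  exists! v, forall x, - B v x = F x.
Proof.
move=> [_ _ N0] c0 coer.
have B0 v : (forall x, B v x = 0) -> v = 0.
  move=> Bv; apply: N0; have := coer v; rewrite Bv pmulr_rle0// => h.
  by apply/eqP; rewrite -sqrf_eq0 eq_le h sqr_ge0.
pose e := vbasis (fullv : {vspace V}).
have fe : free e := basis_free (vbasisP _).
(* The functional [B v] is stored as the vector whose coordinates are its values on the basis; this
   identifies the dual with [V] and makes [A] an endomorphism. Below, [b] stores [- F] in the same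
   way. *)
pose A (v : V) : V := \sum_(i < \dim (fullv : {vspace V})) (B v e`_i) *: e`_i.
have A_lin : linear A.
  move=> a x y; rewrite /A scaler_sumr -big_split/=; apply: eq_bigr => i _.
  by rewrite linearPl/= scalerDl scalerA.
pose L : {linear V -> V} := HB.pack A (GRing.isLinear.Build _ _ _ _ A A_lin).
have BE v x : B v x = \sum_(i < \dim (fullv : {vspace V})) coord e i x * B v e`_i.
  rewrite [in LHS](coord_vbasis (memvf x)) linear_sum/=.
  by apply: eq_bigr => i _; rewrite linearZ.
have FE x : F x = \sum_i coord e i x * F e`_i.
  rewrite [in LHS](coord_vbasis (memvf x)) linear_sum/=.
  by apply: eq_bigr => i _; rewrite linearZ.
have ker0 : lker (linfun L) = 0%VS.
  apply/eqP/lker0P => x y; rewrite !lfunE/= => Axy.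
  apply/eqP; rewrite -subr_eq0; apply/eqP/B0 => z.
  rewrite BE big1// => i _.
  rewrite (elimT freeP fe (fun i => B (x - y) e`_i)) ?mulr0//.
  by rewrite -/(A (x - y)) -[A _]/(L (x - y)) linearB/= Axy subrr.
pose b := - \sum_(i < \dim (fullv : {vspace V})) (F e`_i) *: e`_i.
have /memv_imgP[v _ bv] : b \in limg (linfun L).
  suff -> : limg (linfun L) = fullv by exact: memvf.
  by rewrite lker0_limgf// ker0.
have vF x : - B v x = F x.
  have Avb : \sum_(i < \dim (fullv : {vspace V})) (B v e`_i + F e`_i) *: e`_i = 0.
    under eq_bigr do rewrite scalerDl.
    rewrite big_split/= -/(A v) -[A v]/(L v).
    by move: bv; rewrite lfunE/= => <-; rewrite addNr.
  have Ai0 := elimT freeP fe (fun i => B v e`_i + F e`_i) Avb.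
  rewrite BE FE -sumrN; apply: eq_bigr => i _.
  by rewrite -mulrN; congr (_ * _); apply/eqP; rewrite eq_sym -addr_eq0 addrC Ai0.
exists v; split => // v' v'F; apply/eqP; rewrite -subr_eq0; apply/eqP/B0 => x.
by rewrite linearBl/= -[B v x]opprK -[B v' x]opprK vF v'F subrr.
Qed.

(** [is_norm] does not list nonnegativity; it follows from [0 = N (x - x) <= 2 N x]. *)
Lemma is_norm_ge0 (R : realType) (V : lmodType R) (N : V -> R) x :
  is_norm N -> 0 <= N x.
Proof.
move=> [ND NZ _]; have := ND x (- x); rewrite subrr -scaleN1r NZ normrN1 mul1r.
by rewrite -[X in N X <= _](scale0r x) NZ normr0 mul0r; lra.
Qed.

(** * Convergence of Galerkin approximations *)

Section galerkin.
Context (R : realType) (E : lmodType R) (K : set E) (B : E -> E -> R).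
Hypothesis HB : semi_inner K B.
Hypothesis HC : complete_form K B.

(** For [K = H10 Om] and [B = energy beta Om], this and the next three definitions are convertible
    to [H10_norm], [H10_dual], [strong_cvg] and [weak_cvg]. *)
Definition form_norm (u : E) : R := Num.sqrt (B u u).

Definition form_dual (l : E -> R) : Prop :=
  (forall (c : R) u v, K u -> K v -> l (c *: u + v) = c * l u + l v) /\
  exists C : R, forall u, K u -> `|l u| <= C * form_norm u.

Definition form_strong_cvg (U : R -> E) u : Prop :=
  form_norm (U h - u) @[h --> 0^'+] --> (0 : R).

Definition form_weak_cvg (U : R -> E) u : Prop :=
  forall l, form_dual l -> l (U h) @[h --> 0^'+] --> l u.

Lemma form_dual_repr l : form_dual l ->
  exists2 r, K r & forall u, K u -> l u = B u r.
Proof.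
move=> [lP [C lC]].
have [r [_ [Kr _ _ rl]]] :=
  riesz_on HB HC (@subset_refl _ K) (si0 HB) (siP HB) lP lC.
by exists r => // u Ku; rewrite -rl// (siC HB Kr Ku).
Qed.

(** Two solutions may differ by a null vector; this shows that weak limits do not notice. *)
Lemma dot_eq0 z : K z -> (forall r, K r -> B z r = 0) ->
  forall l, form_dual l -> l z = 0.
Proof. by move=> Kz zr l /form_dual_repr[r Kr ->//]; exact: zr. Qed.

Variables (V : R -> vectType R) (N : forall h : R, V h -> R).
Variables (T : forall h : R, V h -> E).
Arguments N : clear implicits.
Arguments T : clear implicits.
Variables (Bh : forall h : R, {biscalar (V h)}) (Fh : forall h : R, {scalar (V h)}).
Variable L : E -> R.
Hypothesis hN : forall h : R, 0 < h -> is_norm (N h).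
Hypothesis hT : forall h : R, 0 < h -> forall x : V h, K (T h x).
Variables (C0 C1 C3 : R).
Hypotheses (hC0 : 0 < C0) (hC1 : 0 < C1) (hC3 : 0 < C3).
Hypothesis h_i : forall h : R, 0 < h -> forall x : V h,
  form_norm (T h x) <= C0 * N h x.
Hypothesis h_ii : forall psi, K psi ->
  exists psih : forall h : R, V h, form_strong_cvg (fun h => T h (psih h)) psi.
Hypothesis h_iii : forall h : R, 0 < h -> forall x : V h,
  C1 * N h x ^+ 2 <= Bh h x x.
Hypothesis h_iv : forall h : R, 0 < h -> forall x : V h,
  `|Fh h x| <= C3 * N h x.
Hypothesis h_v : forall (vh psih : forall h : R, V h) v psi,
  K v -> K psi ->
  form_weak_cvg (fun h => T h (vh h)) v ->
  form_strong_cvg (fun h => T h (psih h)) psi ->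
  Bh h (vh h) (psih h) @[h --> 0^'+] --> B v psi /\
  Fh h (psih h) @[h --> 0^'+] --> L psi.

Variable vh : forall h : R, V h.
Hypothesis hvh : forall h : R, 0 < h -> forall x : V h, - Bh h (vh h) x = Fh h x.

(** Test the equation with the solution: [C1 N^2 <= B(v, v) = - F(v) <= C3 N], hence [N <= C3 / C1];
    then [h_i] bounds the image under [T]. *)
Lemma discrete_solution_bound h : 0 < h ->
  B (T h (vh h)) (T h (vh h)) <= (C0 * (C3 / C1)) ^+ 2.
Proof.
move=> h0; have Nv0 := is_norm_ge0 (vh h) (hN h0).
have Nv : N h (vh h) <= C3 / C1.
  have h3 := h_iii h0 (vh h); have h4 := h_iv h0 (vh h).
  have := ler_norm (- Fh h (vh h)); rewrite normrN -(hvh h0) opprK => h5.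
  move: Nv0; rewrite le_eqVlt => /orP[/eqP <-|Nv0]; first by rewrite divr_ge0// ltW.
  rewrite ler_pdivlMr// -(ler_pM2l Nv0) mulrC.
  have -> : N h (vh h) * C1 * N h (vh h) = C1 * N h (vh h) ^+ 2 by ring.
  rewrite [leRHS]mulrC; apply: (le_trans h3); apply: (le_trans h5).
  by move: h4; rewrite -(hvh h0).
have KT := hT h0 (vh h).
rewrite -(sqr_sqrtr (si_ge0 HB KT)) ler_sqr ?nnegrE ?sqrtr_ge0//; last first.
  by rewrite mulr_ge0 ?divr_ge0// ltW.
by apply: (le_trans (h_i h0 _)); rewrite ler_pM2l.
Qed.

Lemma strong_cvg_weak (U : R -> E) u : (forall h, 0 < h -> K (U h)) -> K u ->
  form_strong_cvg U u -> form_weak_cvg U u.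
Proof.
move=> KU Ku Uu l /form_dual_repr[r Kr lr].
rewrite (lr u Ku); apply/cvgrPdist_le => e e0.
have c0 : 0 < form_norm r + 1 by rewrite ltr_wpDl// sqrtr_ge0.
near=> h.
have h0 : 0 < h by near: h; exact: nbhs_right_gt.
have Uu_e : form_norm (U h - u) <= e / (form_norm r + 1).
  near: h.
  have /cvgr0_norm_le/(_ _ (divr_gt0 e0 c0)) := Uu.
  by apply: filterS => h; apply: le_trans; exact: ler_norm.
rewrite (lr _ (KU h h0)) distrC -(siBl HB (KU h h0) Ku Kr).
apply: (le_trans (si_CS_sqrt HB (siB HB (KU h h0) Ku) Kr)).
move: Uu_e; rewrite ler_pdivlMr// => /(le_trans _); apply.
by rewrite ler_wpM2l ?sqrtr_ge0// lerDl.
Unshelve. all: by end_near. Qed.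

Lemma seq_cvg_at_right (a : nat -> R) (s : nat -> nat) :
  (forall k, 0 < a k < k.+1%:R^-1) -> (forall j, (j <= s j)%N) ->
  a (s j) @[j --> \oo] --> 0^'+.
Proof.
move=> aP sj P [e /= e0 eP].
suff : \forall j \near \oo, P (a (s j)) by [].
near=> j; have /andP[a0 aj] := aP (s j).
apply: eP => //=; rewrite sub0r normrN gtr0_norm//; apply: (lt_trans aj).
apply: (@le_lt_trans _ _ j.+1%:R^-1).
  by rewrite lef_pV2 ?posrE ?ltr0n// ler_nat ltnS.
by near: j; exact: near_infty_natSinv_lt (PosNum e0).
Unshelve. all: by end_near. Qed.

(* Hypothesis [h_v] speaks of families indexed by all [h > 0]; a weakly
   convergent subsequence is completed to such a family by the strongly
   convergent one given by [h_ii]. *)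
Lemma subsequence_solution (a : nat -> R) :
  (forall k, 0 < a k < k.+1%:R^-1) ->
  exists (s : nat -> nat) (v : E), [/\ K v,
    forall l, form_dual l -> l (T (a (s j)) (vh (a (s j)))) @[j --> \oo] --> l v &
    forall psi, K psi -> - B v psi = L psi].
Proof.
move=> aP; have a0 k : 0 < a k by have /andP[] := aP k.
pose u k := T (a k) (vh (a k)).
have Ku k : K (u k) by exact: hT.
have [s [v [Kv sj us]]] :=
  weak_subsequence HB HC Ku (fun k => discrete_solution_bound (a0 k)).
have usl l : form_dual l -> l (u (s j)) @[j --> \oo] --> l v.
  move=> /form_dual_repr[r Kr lr]; rewrite lr//.
  under eq_fun do rewrite lr//.
  exact: us.
exists s, v; split => // psi Kpsi.
have [ph phv] := h_ii Kv; have [psih psihv] := h_ii Kpsi.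
pose S := range (fun j => a (s j)).
pose wh h : V h := if `[< S h >] then vh h else ph h.
have wcv : form_weak_cvg (fun h => T h (wh h)) v.
  move=> l dl; apply/cvgrPdist_lt => e e0.
  have KTph h : 0 < h -> K (T h (ph h)) by move=> h0; exact: hT.
  have /cvgrPdist_lt/(_ e e0) near_ph := strong_cvg_weak KTph Kv phv dl.
  have /cvgrPdist_lt/(_ e e0)[J _ HJ] := usl l dl.
  (* Below the finitely many values [a (s j)] with [j < J], a point of [S] can only come from an
     index at least [J], where [HJ] applies. *)
  have near_J : \forall h \near (0:R)^'+, forall j : 'I_J, h < a (s j).
    by apply: filter_forall => j; exact: nbhs_right_lt.
  apply: filterS2 near_ph near_J => h ph_h hJ.
  rewrite /wh; case: ifPn => // /asboolP[j _ jh].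
  rewrite -jh; apply: HJ => /=; rewrite leqNgt; apply/negP => jJ.
  by have := hJ (Ordinal jJ); rewrite /= -jh ltxx.
(* Both limits are now restricted to the points [a (s j)], where [wh] is the discrete solution and
   the two sides coincide. *)
have [cB cF] := h_v Kv Kpsi wcv psihv.
have aR := seq_cvg_at_right aP sj.
have cBs : - Bh _ (wh (a (s j))) (psih (a (s j))) @[j --> \oo] --> - B v psi.
  by apply: cvgN; exact: (cvg_comp _ _ aR cB).
have cFs : Fh _ (psih (a (s j))) @[j --> \oo] --> L psi.
  exact: (cvg_comp _ _ aR cF).
apply: (cvg_unique _ cBs) => //.
rewrite (_ : (fun j => _) = (fun j => Fh _ (psih (a (s j)))))//.
apply/funext => j; rewrite -(hvh (a0 _)); congr (- _).
by rewrite /wh ifT//; apply/asboolP; exists j.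
Qed.

Lemma galerkin_weak_cvg : exists v, [/\ K v,
  forall psi, K psi -> - B v psi = L psi & form_weak_cvg (fun h => T h (vh h)) v].
Proof.
(* Any sequence tending to 0 serves to produce [v]; [k.+2] makes the bound [k.+1%:R^-1] strict. *)
have [|_ [v [Kv _ vL]]] := @subsequence_solution (fun k => k.+2%:R^-1).
  move=> k; rewrite invr_gt0 ltr0n/= ltf_pV2 ?posrE ?ltr0n// ltr_nat //.
exists v; split => // l dl; apply/cvgrPdist_lt => e e0; apply: contrapT => nP.
(* If convergence fails for [l], some sequence keeps [l] at distance [e] from [l v], whereas a
   subsequence tends to [l w] for another solution [w], and [l w = l v]. *)
have /choice[a aP] : forall k, exists h, 0 < h < k.+1%:R^-1 /\
    e <= `|l v - l (T h (vh h))|.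
  move=> k; apply: contrapT => nh; apply: nP; near=> h.
  rewrite ltNge; apply/negP => eh; apply: nh; exists h; split => //.
  apply/andP; split; near: h; first exact: nbhs_right_gt.
  by apply: nbhs_right_lt; rewrite invr_gt0.
have [s [w [Kw lw wL]]] := subsequence_solution (fun k => (aP k).1).
have vw : l v = l w.
  apply/eqP; rewrite -subr_eq0; apply/eqP.
  have [lP _] := dl.
  have -> : l v - l w = l ((-1) *: w + v) by rewrite lP//; ring.
  apply: dot_eq0 dl; first exact: (siP HB).
  move=> r Kr; rewrite (siPl HB)//.
  by rewrite -[B v r]opprK -[B w r]opprK vL// wL//; ring.
have /cvgrPdist_lt/(_ e e0) := lw l dl; rewrite -vw => /filter_ex[j].
by rewrite ltNge (aP (s j)).2.
Unshelve. all: by end_near. Qed.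

End galerkin.

(** * Application to the interface problem *)

Theorem lemma3p1 (R : realType) (n : nat) (hn : (0 < n)%N)
  (Om : set 'rV[R]_n) (phi : 'rV[R]_n -> R) (nu : 'rV[R]_n -> 'rV[R]_n)
  (beta : 'rV[R]_n -> 'M[R]_n) (m M : R)
  (hOm : smooth_bounded_domain Om)
  (hphi : interface Om phi)
  (hnu : normal_extension Om phi nu)
  (hm : 0 < m) (hmM : m < M)
  (hbeta : piecewise_C1 Om phi beta)
  (hbeta_ell : elliptic_coef Om m M beta)
  (f : 'rV[R]_n -> R) (g a b : sobolev R n)
  (hf : L2 Om f) (hg : H1 Om g) (ha : H10 Om a) (hb : H10 Om b)
  (V : R -> vectType R)
  (N : forall h : R, V h -> R)
  (T : forall h : R, V h -> sobolev R n)
  (Bh : forall h : R, {biscalar (V h)})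
  (Fh : forall h : R, {scalar (V h)})
  (hN : forall h : R, 0 < h -> is_norm (N h))
  (hT : forall h : R, 0 < h -> forall x : V h, H10 Om (T h x))
  (C0 C1 C2 C3 : R)
  (hC0 : 0 < C0) (hC1 : 0 < C1) (hC2 : 0 < C2) (hC3 : 0 < C3)
  (h_i : forall h : R, 0 < h -> forall x : V h,
     H10_norm beta Om (T h x) <= C0 * N h x)
  (h_ii : forall psi : sobolev R n, H10 Om psi ->
     exists psih : forall h : R, V h,
       strong_cvg beta Om (fun h => T h (psih h)) psi)
  (h_iii : forall h : R, 0 < h -> forall x y : V h,
     C1 * N h x ^+ 2 <= Bh h x x /\ `|Bh h x y| <= C2 * N h x * N h y)
  (h_iv : forall h : R, 0 < h -> forall x : V h, `|Fh h x| <= C3 * N h x)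
  (h_v : forall (vh psih : forall h : R, V h) (v psi : sobolev R n),
     H10 Om v -> H10 Om psi ->
     weak_cvg beta Om (fun h => T h (vh h)) v ->
     strong_cvg beta Om (fun h => T h (psih h)) psi ->
     Bh h (vh h) (psih h) @[h --> 0^'+] --> energy beta Om v psi /\
     Fh h (psih h) @[h --> 0^'+] --> load beta Om phi nu f g a b psi) :
  (forall h : R, 0 < h ->
     exists! vh : V h, forall x : V h, - Bh h vh x = Fh h x) /\
  exists (u : 'rV[R]_n -> R) (w : 'rV[R]_n -> 'rV[R]_n),
    [/\ H10 Om (shifted Om phi g a u w),
        forall psi : sobolev R n, H10 Om psi ->
          - energy beta Om (shifted Om phi g a u w) psi =
          load beta Om phi nu f g a b psi,
        forall (u' : 'rV[R]_n -> R) (w' : 'rV[R]_n -> 'rV[R]_n),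
          H10 Om (shifted Om phi g a u' w') ->
          (forall psi : sobolev R n, H10 Om psi ->
             - energy beta Om (shifted Om phi g a u' w') psi =
             load beta Om phi nu f g a b psi) ->
          {ae lebesgue_rV R n, forall x, Om x -> u' x = u x} &
        forall vh : forall h : R, V h,
          (forall h : R, 0 < h -> forall x : V h, - Bh h (vh h) x = Fh h x) ->
          weak_cvg beta Om (fun h => T h (vh h)) (shifted Om phi g a u w)].
Proof.
have [oOm _ _ bOm _] := hOm.
have mOm := rV_open_measurable oOm; have muOm := bounded_measure_lty bOm mOm.
have es := energy_semi_inner oOm bOm hphi hm hbeta hbeta_ell.
have ec := energy_complete oOm bOm hphi hm hbeta hbeta_ell hn hmM.
have solve h (h0 : 0 < h) : exists! vh : V h, forall x : V h, - Bh h vh x = Fh h x.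
  apply: (coercive_solvable (Fh h) (hN h h0) hC1) => x.
  by have [] := h_iii h h0 x x.
split => //.
(* The limit must be exhibited before a family of solutions is given, so one is chosen here, with
   the value 0 for [h <= 0]. *)
have sol h : {vh : V h | 0 < h -> forall x, - Bh h vh x = Fh h x}.
  apply: cid; have [h0|h0] := boolP (0 < h); last by exists 0.
  by have [v [vP _]] := solve h h0; exists v.
pose vh h := sval (sol h); have hvh h := svalP (sol h).
have gal := galerkin_weak_cvg es ec hN hT hC0 hC1 hC3 h_i h_ii
  (fun h h0 x => (h_iii h h0 x x).1) h_iv h_v.
have [v [Kv vL vw]] := gal _ hvh.
pose u x := v.1 x + g.1 x - a.1 x * \1_(Omega_minus Om phi) x.
have uv : shifted Om phi g a u v.2 = v.
  rewrite /shifted [RHS]surjective_pairing; congr pair.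
  by apply/funext => x; rewrite /u; ring.
have uniq v' : H10 Om v' -> (forall psi, H10 Om psi ->
      - energy beta Om v' psi = load beta Om phi nu f g a b psi) ->
    forall psi, H10 Om psi -> energy beta Om (v' - v) psi = 0.
  move=> Kv' v'L psi Kpsi; rewrite (siBl es)//.
  by rewrite -[X in X - _]opprK v'L// -vL// opprK subrr.
exists u, v.2; rewrite uv; split => //.
- move=> u' w' Kv' v'L.
  have Kz := siB es Kv' Kv.
  (* The difference of two solutions has zero energy, hence zero H^1 norm, so its function vanishes
     almost everywhere. *)
  have [C C0_ CP] := H1_dot_le_energy oOm bOm hphi hm hbeta hbeta_ell hn.
  have z0 := uniq _ Kv' v'L _ Kz.
  have Lz := H10_L2_pair Kz.
  have L0 : L2_dot Om (shifted Om phi g a u' w' - v).1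
      (shifted Om phi g a u' w' - v).1 = 0.
    apply/eqP; rewrite eq_le (si_ge0 (L2_semi_inner mOm) Lz.1) andbT.
    apply: (le_trans (L2_dot_le_H1 mOm Lz)); apply: (le_trans (CP _ Kz)).
    by rewrite z0 mulr0.
  have := L2_dot_eq0 mOm Lz.1 L0; apply: filterS => x + Omx => /(_ Omx).
  by rewrite /= /u => /eqP; rewrite subr_eq0 => /eqP <-; ring.
- move=> vh' hvh'.
  (* The given family has its own weak limit [v']; it solves the same equation as [v], so every
     bounded functional takes the same value at both. *)
  have [v' [Kv' v'L v'w]] := gal _ hvh'.
  move=> l dl; have [lP _] := dl.
  suff -> : l v = l v' by exact: v'w.
  apply/eqP; rewrite eq_sym -subr_eq0; apply/eqP.
  have -> : l v' - l v = l ((-1) *: v + v') by rewrite lP//; ring.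
  apply: (dot_eq0 es ec) dl; first exact: (siP es).
  by move=> r Kr; rewrite scaleN1r addrC; exact: uniq.
Qed.
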